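(* Let $\mathsf{k}$ be an $F$-finite field of positive characteristic, and let $a,b$ be positive integers. The $F$-signature of the intersection algebra $\mathcal B=\mathcal B(a,b)$ (case $n=1$) is $$s(\mathcal B)=\begin{cases}\dfrac{3b-1}{6ab}+\dfrac1{2a}=\dfrac{6b-1}{6ab} & \text{when } a>b,\\[2mm] 2\left(\dfrac{3a-1}{6a^2}\right)=\dfrac{3a-1}{3a^2} & \text{when } a=b.\end{cases}$$
   Context: $\mathbb N=\mathbb Z_{\ge 0}$. Let $R=\mathsf{k}[x]$, $I=(x^a)$, $J=(x^b)$. The intersection algebra is $\mathcal B(a,b)=\bigoplus_{r,s\in\mathbb N}(I^r\cap J^s)$, realized as the subring $\sum_{r,s}(I^r\cap J^s)u^rv^s$ of $R[u,v]$; it is a 3-dimensional normal domain, spanned over $\mathsf{k}$ by the monomials $u^rv^sx^t$ with $r,s\in\mathbb N$, $t\ge\max(ar,bs)$, and $\mathfrak m$ denotes its homogeneous maximal ideal, generated by the monomials $\ne1$. A field of characteristic $p>0$ is $F$-finite if $[\mathsf{k}:\mathsf{k}^p]<\infty$. $s(\mathcal B)$ is the $F$-signature of $\mathcal B$ as a graded ring, i.e. of $\mathcal B_{\mathfrak m}$: $s=\lim_{e\to\infty} c_e/p^{e(d+\alpha)}$, where $d=\dim\mathcal B$, $p^\alpha=[\mathsf{k}:\mathsf{k}^p]$, and $c_e$ is the maximal rank of a free direct summand of $F^e_*\mathcal B_{\mathfrak m}$ as a $\mathcal B_{\mathfrak m}$-module. *)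

(* Defs.v *)
From HB Require Import structures.
From mathcomp Require Import all_boot all_order all_algebra.
From mathcomp Require Import all_classical all_reals all_analysis.
Set Implicit Arguments.
Unset Strict Implicit.
Unset Printing Implicit Defensive.
Import GRing.Theory numFieldNormedType.Exports.
Local Open Scope classical_set_scope.
Local Open Scope ring_scope.

Section Ideals.
Variable A : comNzRingType.
Implicit Types (I J S P : set A).

Definition is_ideal I :=
  [/\ I 0, forall x y, I x -> I y -> I (x + y) & forall c x, I x -> I (c * x)].

Definition ideal_gen S : set A := smallest is_ideal S.

Definition ideal_mul I J : set A :=
  ideal_gen [set z | exists x y, [/\ I x, J y & z = x * y]].

Fixpoint ideal_pow I n : set A :=
  if n is n'.+1 then ideal_mul I (ideal_pow I n') else setT.

Definition is_prime_ideal P :=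
  [/\ is_ideal P, ~ P 1 & forall x y, P (x * y) -> P x \/ P y].

Definition has_prime_chain (n : nat) :=
  exists P : nat -> set A,
    (forall i, (i <= n)%N -> is_prime_ideal (P i)) /\
    (forall i, (i < n)%N -> P i `<` P i.+1).

Definition krull_dim (d : nat) :=
  has_prime_chain d /\ forall n, has_prime_chain n -> (n <= d)%N.

Lemma ideal_gen_ideal S : is_ideal (ideal_gen S).
Proof.
split; first by move=> I [[]].
  move=> x y Sx Sy I II; have [[_ ID _] _] := II.
  by apply: ID; [apply: Sx | apply: Sy].
move=> c x Sx I II; have [[_ _ IM] _] := II.
by apply: IM; apply: Sx.
Qed.

Lemma sub_ideal_gen S : S `<=` ideal_gen S.
Proof. by move=> x Sx I [_]; apply. Qed.

Lemma ideal_gen_min S I : is_ideal I -> S `<=` I -> ideal_gen S `<=` I.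
Proof. by move=> idI SI x; apply. Qed.

Lemma ideal_pow_ideal I n : is_ideal (ideal_pow I n).
Proof. by case: n => [|n] //=; apply: ideal_gen_ideal. Qed.

Lemma ideal_pow_mul I m n x y :
  ideal_pow I m x -> ideal_pow I n y -> ideal_pow I (m + n) (x * y).
Proof.
move=> + Iy; elim: m x => [|m IHm] x.
  by move=> _; rewrite add0n; case: (ideal_pow_ideal I n) => _ _; apply.
have [z0 zD zM] := ideal_pow_ideal I (m.+1 + n).
suff sub : ideal_pow I m.+1 `<=` [set x | ideal_pow I (m.+1 + n) (x * y)].
  exact: sub.
apply: ideal_gen_min.
  split=> /=; first by rewrite mul0r.
    by move=> u v ? ?; rewrite mulrDl; apply: zD.
  by move=> c u ?; rewrite -mulrA; apply: zM.
move=> _ [u [v [Iu Iv ->]]] /=; rewrite -mulrA.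
by apply: sub_ideal_gen; exists u, (v * y); split=> //; apply: IHm.
Qed.

Lemma ideal_pow_principal c n x :
  ideal_pow (ideal_gen [set c]) n x <-> exists y, x = y * c ^+ n.
Proof.
elim: n x => [|n IHn] x; first by split=> // _; exists x; rewrite mulr1.
split; last first.
  move=> [y ->]; have [_ _ zM] := ideal_pow_ideal (ideal_gen [set c]) n.+1.
  apply: zM; apply: sub_ideal_gen; exists c, (c ^+ n); rewrite exprS.
  split=> //; first exact: sub_ideal_gen.
  by apply/IHn; exists 1; rewrite mul1r.
have mult_ideal m : is_ideal [set x | exists y, x = y * c ^+ m].
  split=> /=; first by exists 0; rewrite mul0r.
    by move=> _ _ [u ->] [v ->]; exists (u + v); rewrite mulrDl.
  by move=> d _ [u ->]; exists (d * u); rewrite mulrA.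
suff sub : ideal_pow (ideal_gen [set c]) n.+1 `<=`
  [set x | exists y, x = y * c ^+ n.+1] by exact: sub.
apply: ideal_gen_min => //.
move=> _ [u [v [Iu /IHn[w ->] ->]]] /=.
have [t ->] : exists t, u = t * c ^+ 1.
  suff sub : ideal_gen [set c] `<=` [set x | exists y, x = y * c ^+ 1].
    exact: sub.
  by apply: ideal_gen_min => // _ ->; exists 1; rewrite mul1r.
by exists (t * w); rewrite mulrACA -exprD.
Qed.

End Ideals.

Section FreeSummands.
Variables (A : nzRingType) (V : lmodType A).

Definition is_submodule (N : set V) :=
  [/\ N 0, forall x y, N x -> N y -> N (x + y) & forall c x, N x -> N (c *: x)].

Definition free_of_rank (N : set V) (n : nat) :=
  exists v : 'I_n -> V,
    (forall x, N x <-> exists c : 'I_n -> A, x = \sum_i c i *: v i) /\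
    (forall c : 'I_n -> A, \sum_i c i *: v i = 0 -> forall i, c i = 0).

Definition direct_sum_decomposition (N W : set V) :=
  [/\ is_submodule N, is_submodule W, N `&` W = [set 0] &
      forall x, exists y z, [/\ N y, W z & x = y + z]].

Definition has_free_summand (n : nat) :=
  exists N W, direct_sum_decomposition N W /\ free_of_rank N n.

Definition max_free_rank (c : nat) :=
  has_free_summand c /\ forall n, has_free_summand n -> (n <= c)%N.

End FreeSummands.

(* F^e_* A: the additive group of A, on which a acts as multiplication by
   a ^ (p ^ e). *)
Definition frobenius_push (A : comNzRingType) (p : nat)
  (hp : p \in [pchar A]) (e : nat) : Type := A.

Section FrobeniusPush.
Variables (A : comNzRingType) (p : nat) (hp : p \in [pchar A]) (e : nat).
Local Notation FA := (frobenius_push hp e).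

HB.instance Definition _ := GRing.Zmodule.copy FA A.

Definition frobenius_scale (c : A) (x : FA) : FA := c ^+ (p ^ e) * (x : A).

Lemma frobenius_scaleA c d x :
  frobenius_scale c (frobenius_scale d x) = frobenius_scale (c * d) x.
Proof. by rewrite /frobenius_scale exprMn mulrA. Qed.

Lemma frobenius_scale1 : left_id 1 frobenius_scale.
Proof. by move=> x; rewrite /frobenius_scale expr1n mul1r. Qed.

Lemma frobenius_scaleDr : right_distributive frobenius_scale +%R.
Proof. by move=> c x y; rewrite /frobenius_scale mulrDr. Qed.

Lemma frobenius_scaleDl x : {morph frobenius_scale^~ x : c d / c + d}.
Proof.
move=> c d; rewrite /frobenius_scale exprDn_pchar ?mulrDl //.
rewrite pnatX; apply/orP; left; apply/pnatP => //.
  by rewrite prime_gt0 ?(pcharf_prime hp).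
by move=> q qp; rewrite (dvdn_prime2 qp (pcharf_prime hp)) => /eqP ->.
Qed.

HB.instance Definition _ := GRing.Zmodule_isLmodule.Build A FA
  frobenius_scaleA frobenius_scale1 frobenius_scaleDr frobenius_scaleDl.

End FrobeniusPush.

(* [k : k^p] = n, through a basis of k over its subfield k^p. *)
Definition frobenius_degree (k : fieldType) (p n : nat) :=
  exists w : 'I_n -> k,
    (forall x, exists c : 'I_n -> k, x = \sum_i c i ^+ p * w i) /\
    (forall c : 'I_n -> k, \sum_i c i ^+ p * w i = 0 ->
       forall i, c i ^+ p = 0).

Definition F_finite (k : fieldType) (p : nat) :=
  exists n, frobenius_degree k p n.

(* A[u, v] is {poly {poly A}}, the inner variable being u and the outer one v:
   the coefficient of u^r v^s in f is f`_s`_r. *)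
Definition intersection_algebra_set (A : comNzRingType) (I J : set A) :
    set {poly {poly A}} :=
  [set f : {poly {poly A}} |
     forall r s, (ideal_pow I r `&` ideal_pow J s) f`_s`_r].

Definition intersection_algebra_pred (A : comNzRingType) (I J : set A) :
    {pred {poly {poly A}}} :=
  fun f => `[< intersection_algebra_set I J f >].

Section IntersectionAlgebraRing.
Variables (A : comNzRingType) (I J : set A).

Lemma intersection_algebra_subring :
  subring_closed (intersection_algebra_pred I J).
Proof.
have idI r s : is_ideal (ideal_pow I r `&` ideal_pow J s).
  have [I0 ID IM] := ideal_pow_ideal I r.
  have [J0 JD JM] := ideal_pow_ideal J s.
  split=> //; first by move=> x y [? ?] [? ?]; split; [apply: ID|apply: JD].
  by move=> c x [? ?]; split; [apply: IM|apply: JM].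
have idsum r s (T : finType) (F : T -> A) :
    (forall i, (ideal_pow I r `&` ideal_pow J s) (F i)) ->
    (ideal_pow I r `&` ideal_pow J s) (\sum_i F i).
  have [H0 HD _] := idI r s => HF.
  by apply: big_ind => // x y; apply: HD.
split.
- apply/asboolP => r s; have [H0 _ _] := idI r s.
  rewrite coef1; case: s H0 => [|s] H0 /=; last by rewrite coef0.
  by rewrite coef1; case: r H0 => [|r].
- move=> f g /asboolP Hf /asboolP Hg; apply/asboolP => r s.
  have [_ HD HM] := idI r s; rewrite !coefB -mulN1r.
  by apply: HD; [apply: Hf | apply: HM; apply: Hg].
- move=> f g /asboolP Hf /asboolP Hg; apply/asboolP => r s.
  rewrite coefM coef_sum; apply: (idsum) => -[i /= ltis].
  rewrite coefM; apply: (idsum) => -[j /= ltjr].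
  have [If Jf] := Hf j i; have [Ig Jg] := Hg (r - j)%N (s - i)%N.
  split.
    by have := ideal_pow_mul If Ig; rewrite subnKC // -ltnS.
  by have := ideal_pow_mul Jf Jg; rewrite subnKC // -ltnS.
Qed.

HB.instance Definition _ := GRing.isSubringClosed.Build {poly {poly A}}
  (intersection_algebra_pred I J) intersection_algebra_subring.

Record intersection_algebra := IntersectionAlgebra {
  ia_val :> {poly {poly A}};
  ia_valP : ia_val \in intersection_algebra_pred I J }.

HB.instance Definition _ := [isSub for ia_val].
HB.instance Definition _ := [Choice of intersection_algebra by <:].
HB.instance Definition _ :=
  [SubChoice_isSubComNzRing of intersection_algebra by <:].

End IntersectionAlgebraRing.

Section MonomialIntersectionAlgebra.
Variables (k : fieldType) (a b : nat).

Definition Balg : comNzRingType :=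
  intersection_algebra (ideal_gen [set ('X^a : {poly k})])
                       (ideal_gen [set ('X^b : {poly k})]).

(* u^r v^s x^t *)
Definition monomial (r s t : nat) : {poly {poly {poly k}}} :=
  (('X^t : {poly k}) *: ('X^r : {poly {poly k}})) *: 'X^s.

Definition Bmax : set Balg :=
  ideal_gen [set f : Balg |
    f != 1 /\ exists r s t, ia_val f = monomial r s t].

(* The localization of the domain Balg at Bmax, as the set of fractions f / g
   with g outside Bmax in the fraction field of k[x][u, v]. *)
Definition Bloc_set : set {fraction {poly {poly {poly k}}}} :=
  [set z | exists f g : Balg,
     ~ Bmax g /\ z = tofrac (ia_val f) / tofrac (ia_val g)].

Definition Bloc_pred : {pred {fraction {poly {poly {poly k}}}}} :=
  fun z => `[< Bloc_set z >].

Lemma coef_monomial r s t i j l :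
  (monomial r s t)`_i`_j`_l = ((l == t) && (j == r) && (i == s))%:R.
Proof.
rewrite /monomial coefZ coefXn; case: (i == s); last by rewrite mulr0 !coef0 andbF.
rewrite mulr1 coefZ coefXn; case: (j == r); last by rewrite mulr0 coef0 andbF.
by rewrite mulr1 coefXn !andbT.
Qed.

Lemma ideal_powX c n (q : {poly k}) l : ideal_pow (ideal_gen [set 'X^c]) n q ->
  q`_l != 0 -> ideal_pow (ideal_gen [set ('X^c : {poly k})]) n 'X^l.
Proof.
move=> /ideal_pow_principal[y ->]; rewrite -exprM coefMXn.
case: ltnP => [_|le_cl _]; first by rewrite eqxx.
apply/ideal_pow_principal; exists 'X^(l - c * n).
by rewrite -exprM -exprD subnK.
Qed.

Lemma monomial_mem (f : Balg) r s t : (ia_val f)`_s`_r`_t != 0 ->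
  monomial r s t \in
    intersection_algebra_pred (ideal_gen [set 'X^a]) (ideal_gen [set 'X^b]).
Proof.
move=> nz; have /asboolP fP := ia_valP f; apply/asboolP => j i.
have I0 n : ideal_pow (ideal_gen [set ('X^a : {poly k})]) n 0.
  by case: (ideal_pow_ideal (ideal_gen [set ('X^a : {poly k})]) n).
have J0 n : ideal_pow (ideal_gen [set ('X^b : {poly k})]) n 0.
  by case: (ideal_pow_ideal (ideal_gen [set ('X^b : {poly k})]) n).
rewrite /monomial coefZ coefXn.
case: (eqVneq i s) => [->|_]; last by rewrite mulr0 coef0.
rewrite mulr1 coefZ coefXn.
case: (eqVneq j r) => [->|_]; last first.
  by rewrite mulr0; split; [exact: I0 | exact: J0].
by rewrite mulr1; have [fI fJ] := fP r s; split; [exact: ideal_powX fI nz | exact: ideal_powX fJ nz].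
Qed.

Lemma BmaxE (f : Balg) : Bmax f <-> (ia_val f)`_0`_0`_0 = 0.
Proof.
have [m0 mD mM] : is_ideal Bmax by apply: ideal_gen_ideal.
split.
  move: f; apply: ideal_gen_min.
    split=> /=; first by rewrite !coef0.
      by move=> x y x0 y0; rewrite !coefD x0 y0 addr0.
    by move=> c x x0; rewrite !coef0M x0 mulr0.
  move=> f /= [f1 [r [s [t fE]]]]; rewrite fE coef_monomial.
  case: andP => // -[/andP[/eqP t0 /eqP r0] /eqP s0].
  case/eqP: f1; apply: val_inj; rewrite /= fE -t0 -r0 -s0 /monomial.
  by rewrite !expr0 !scale1r.
move=> f0.
pose M := [set h : {poly {poly {poly k}}} | exists2 g, Bmax g & ia_val g = h].
have M0 : M 0 by exists 0.
have MD x y : M x -> M y -> M (x + y).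
  by move=> [g gm <-] [h hm <-]; exists (g + h) => //; apply: mD.
suff: M (ia_val f) by move=> [g gm] /val_inj <-.
have -> : ia_val f = \sum_(s < size (ia_val f))
    \sum_(r < size (ia_val f)`_s) \sum_(t < size (ia_val f)`_s`_r)
      ((ia_val f)`_s`_r`_t)%:P%:P%:P * monomial r s t.
  rewrite -[LHS]coefK poly_def; apply: eq_bigr => s _.
  rewrite -[X in X *: _]coefK poly_def scaler_suml; apply: eq_bigr => r _.
  rewrite -[X in (X *: _) *: _]coefK poly_def !scaler_suml.
  apply: eq_bigr => t _; rewrite /monomial -!mul_polyC !rmorphM /=.
  by rewrite !mulrA.
apply: big_ind => // s _; apply: big_ind => // r _; apply: big_ind => // t _.
have [->|nz] := eqVneq (ia_val f)`_s`_r`_t 0; first by rewrite !polyC0 mul0r.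
have mon := monomial_mem nz.
have cst : ((ia_val f)`_s`_r`_t)%:P%:P%:P \in
    intersection_algebra_pred (ideal_gen [set 'X^a]) (ideal_gen [set 'X^b]).
  apply/asboolP => j i.
  have [I0 _ _] := ideal_pow_ideal (ideal_gen [set ('X^a : {poly k})]) j.
  have [J0 _ _] := ideal_pow_ideal (ideal_gen [set ('X^b : {poly k})]) i.
  rewrite coefC; case: i J0 => [|i] J0 /=; last by rewrite coef0.
  by rewrite coefC; case: j I0 => [|j] I0 /=.
exists ((IntersectionAlgebra cst : Balg) * (IntersectionAlgebra mon : Balg)) => //.
apply: mM; apply: sub_ideal_gen; split; last by exists r, s, t.
apply: contra_neq nz => /(congr1 (fun g : Balg => (ia_val g)`_0`_0`_0)) /=.
rewrite coef_monomial !coef1 /= => /eqP.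
case: andP => [|_]; last by rewrite eq_sym oner_eq0.
by move=> [/andP[/eqP <- /eqP <-] /eqP <-] _.
Qed.

Lemma Bmax_prime : is_prime_ideal Bmax.
Proof.
split; first exact: ideal_gen_ideal.
  by move/BmaxE => /eqP; rewrite /= !coef1 /= oner_eq0.
move=> f g /BmaxE; rewrite /= !coef0M => /eqP; rewrite mulf_eq0.
by case/orP => /eqP ?; [left|right]; apply/BmaxE.
Qed.

Lemma Bloc_subring : subring_closed Bloc_pred.
Proof.
have [_ m1 mM] := Bmax_prime.
have nz g : ~ Bmax g -> tofrac (ia_val g) != 0.
  move=> gm; rewrite tofrac_eq0; apply/eqP => g0.
  by apply: gm; apply/BmaxE; rewrite g0 !coef0.
have mN f g : ~ Bmax f -> ~ Bmax g -> ~ Bmax (f * g) by move=> ? ? /mM[].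
split.
- by apply/asboolP; exists 1, 1; split=> //=; rewrite tofrac1 divr1.
- move=> _ _ /asboolP[f [g [gm ->]]] /asboolP[f' [g' [gm' ->]]].
  apply/asboolP; exists (f * g' - f' * g), (g * g'); split; first exact: mN.
  by rewrite /= -mulNr addf_div ?nz // mulNr -!rmorphM -rmorphB.
- move=> _ _ /asboolP[f [g [gm ->]]] /asboolP[f' [g' [gm' ->]]].
  apply/asboolP; exists (f * f'), (g * g'); split; first exact: mN.
  by rewrite /= !rmorphM /= mulf_div.
Qed.

HB.instance Definition _ := GRing.isSubringClosed.Build
  {fraction {poly {poly {poly k}}}} Bloc_pred Bloc_subring.

Record Bloc := MkBloc {
  bloc_val :> {fraction {poly {poly {poly k}}}};
  bloc_valP : bloc_val \in Bloc_pred }.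

HB.instance Definition _ := [isSub for bloc_val].
HB.instance Definition _ := [Choice of Bloc by <:].
HB.instance Definition _ := [SubChoice_isSubComNzRing of Bloc by <:].

Lemma pchar_Bloc p : p \in [pchar k] -> p \in [pchar Bloc].
Proof.
rewrite !inE => /andP[pp /eqP p0]; rewrite pp /=; apply/eqP/val_inj.
rewrite rmorph_nat rmorph0 -(rmorph_nat (@tofrac _)) -!polyC_natr p0.
by rewrite !polyC0 rmorph0.
Qed.

End MonomialIntersectionAlgebra.

(* The exponent alpha with p ^ alpha = [k : k^p] is taken in R; that it is
   actually an integer is not needed to define it. *)
Definition is_F_signature (R : realType) (k : fieldType) (p : nat)
    (hp : p \in [pchar k]) (a b : nat) (s : R) :=
  exists (d n : nat) (alpha : R) (c : nat -> nat),
    [/\ krull_dim (Balg k a b) d,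
        frobenius_degree k p n,
        p%:R `^ alpha = n%:R,
        forall e, max_free_rank (frobenius_push (pchar_Bloc a b hp) e) (c e) &
        (fun e : nat => (c e)%:R / p%:R `^ (e%:R * (d%:R + alpha))) @ \oo --> s].

(* Main.v *)
Require Import Defs.
From HB Require Import structures.
From mathcomp Require Import all_boot all_order all_algebra.
From mathcomp Require Import all_classical all_reals all_analysis.
From mathcomp Require Import ring lra zify.
Set Implicit Arguments.
Unset Strict Implicit.
Unset Printing Implicit Defensive.
Import Order.TTheory GRing.Theory Num.Theory numFieldNormedType.Exports.
Local Open Scope classical_set_scope.
Local Open Scope ring_scope.

(** The intersection algebra is the semigroup ring of the integer points of the
    cone [r >= 0, s >= 0, t >= a r, t >= b s], and its F-signature is the volume
    of the slab
      [0 <= r < 1, 0 <= s < 1, a r <= t < a r + 1, b s <= t < b s + 1]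
    cut out by asking each of the four primitive facet forms to lie in
    [[0, 1)].  The proof makes this elementary.

    Put [q = p ^ e] and let [A] be the localization at the monomial maximal
    ideal.  A module has a free summand of rank [c] exactly when it carries [c]
    elements and [c] linear forms that are dual to each other
    ([has_free_summandP]).  In the Frobenius push-forward of [A] take the
    elements [w_j u^r v^s x^t], where the [w_j] form a basis of [k] over [k^q]
    and [(r, s, t)] runs over the points whose four facet forms lie in [[0, q)].

    - They span a free summand: the dual forms keep the coefficients
      at the points congruent to [(r, s, t)] modulo [q], take [q]-th roots, and
      divide the shifted exponents by [q]; the shifted point remains in the cone
      because its facet forms are integers larger than [-1]
      ([free_summand_ge]).
    - No larger free summand exists: a monomial with a facet form at least [q] is
      sent into the maximal ideal by every linear form, since one may move it by
      [q] times a lattice vector on which that facet form is [-1] and the others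
      are nonnegative ([form_vanish_term]).  So the elements above span modulo
      the maximal ideal everything that linear forms can detect, and comparing
      ranks over [k] bounds any free summand ([free_summand_le]).

    Hence the free rank is [k : k^p]^e times the number of lattice points of the
    slab scaled by [q] ([frobenius_push_free_rank]).  For fixed [(r, s)] there
    are [max (0, q - |a r - b s|)] values of [t].  This tent function is
    1-Lipschitz in each variable, so its sum over [(a r, b s)] is, up to an error
    of order [q ^ 2], the fraction [1 / (a b)] of its sum over all integer points
    of the rectangle [a q] by [b q]; the latter sum has a closed form
    ([tent_sum_gt], [tent_sum_eq]).

    The dimension is 3: the kernels of the evaluations [u = 0], [u = v = 0] and
    [u = v = x = 0] give a chain of length 3, and a chain of length 4 would
    supply four elements which, being algebraically dependent, satisfy a relation
    that can be peeled one variable at a time down to a nonzero constant lying in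
    a prime ideal ([prime_chain_bound]). *)

(** * Free summands and dual families *)

Section FreeSummandCriterion.
Variables (A : nzRingType) (V : lmodType A).

Lemma scalar_form (phi : V -> A) :
  (forall c x y, phi (c *: x + y) = c * phi x + phi y) ->
  exists f : {scalar V}, f =1 phi.
Proof.
move=> lin.
pose m := GRing.isLinear.Build A V A *%R phi lin.
pose f : {scalar V} := HB.pack phi m.
by exists f.
Qed.

(** The coordinates along a free summand extend by zero on the complement to
    linear forms; conversely dual families split the module, the complement
    being the common kernel of the forms. *)
Lemma has_free_summandP n : has_free_summand V n <->
  exists (v : 'I_n -> V) (phi : 'I_n -> {scalar V}),
    forall i j, phi i (v j) = (i == j)%:R.
Proof.
split.
  move=> [N [W [[[N0 ND NZ] [W0 WD WZ] NW dec] [v [span free]]]]].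
  have coordE x : exists c : 'I_n -> A, W (x - \sum_i c i *: v i).
    have [y [z [/span[c ->] Wz ->]]] := dec x.
    by exists c; rewrite addrAC subrr add0r.
  have uniq x c d : W (x - \sum_i c i *: v i) -> W (x - \sum_i d i *: v i) ->
      c =1 d.
    move=> Wc Wd i; apply/eqP; rewrite -subr_eq0; apply/eqP; move: i.
    apply: (free (fun i => c i - d i)).
    have diff : \sum_i (c i - d i) *: v i =
        (x - \sum_i d i *: v i) - (x - \sum_i c i *: v i).
      rewrite opprB addrC addrA addrNK -sumrB.
      by apply: eq_bigr => i _; rewrite scalerBl.
    suff : (N `&` W) (\sum_i (c i - d i) *: v i) by rewrite NW.
    split; first by apply/span; exists (fun i => c i - d i).
    by rewrite diff; apply: WD => //; rewrite -scaleN1r; apply: WZ.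
  have [C CP] := choice coordE.
  have lin i c x y : C (c *: x + y) i = c * C x i + C y i.
    apply: (uniq (c *: x + y)) (fun i => c * C x i + C y i) _ _ i => //.
    rewrite (_ : _ - _ = c *: (x - \sum_i C x i *: v i)
       + (y - \sum_i C y i *: v i)); first by apply: WD => //; apply: WZ.
    rewrite scalerBr addrACA -opprD; congr (_ - _).
    rewrite scaler_sumr -big_split; apply: eq_bigr => j _.
    by rewrite scalerDl scalerA.
  have formE i : exists f : {scalar V}, f =1 (fun x => C x i).
    exact: scalar_form.
  have [phi phiE] := choice formE.
  exists v, phi => i j; rewrite phiE.
  apply: (uniq (v j)) (fun i => (i == j)%:R) _ _ i => //.
  rewrite (bigD1 j) //= eqxx scale1r big1 ?addr0 ?subrr // => i /negPf ->.
  by rewrite scale0r.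
move=> [v [phi phiv]].
have phiS c i : phi i (\sum_j c j *: v j) = c i.
  rewrite raddf_sum (bigD1 i) //= linearZ /= phiv eqxx mulr1 big1 ?addr0 //.
  by move=> j ji; rewrite linearZ /= phiv eq_sym (negPf ji) mulr0.
exists [set x | exists c : 'I_n -> A, x = \sum_i c i *: v i].
exists [set x | forall i, phi i x = 0]; split; last first.
  exists v; split=> // c c0 i.
  by rewrite -(phiS c) c0 raddf0.
split.
- split.
  + by exists (fun=> 0); rewrite big1 // => i _; rewrite scale0r.
  + move=> _ _ [c ->] [d ->]; exists (fun i => c i + d i).
    by rewrite -big_split; apply: eq_bigr => i _; rewrite scalerDl.
  + move=> c _ [d ->]; exists (fun i => c * d i).
    by rewrite scaler_sumr; apply: eq_bigr => i _; rewrite scalerA.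
- split=> [i|x y x0 y0 i|c x x0 i]; first by rewrite raddf0.
    by rewrite raddfD /= x0 y0 addr0.
  by rewrite linearZ /= x0 mulr0.
- apply/seteqP; split=> x /=; last first.
    move=> ->; split; last by move=> i; rewrite raddf0.
    by exists (fun=> 0); rewrite big1 // => i _; rewrite scale0r.
  move=> [[c ->] c0]; rewrite big1 // => i _.
  by rewrite -(phiS c) c0 scale0r.
move=> x; exists (\sum_i phi i x *: v i), (x - \sum_i phi i x *: v i).
split; first by exists (phi^~ x).
  by move=> i; rewrite raddfB /= phiS subrr.
by rewrite addrC subrK.
Qed.

Lemma free_summand_card (I : finType) (b : I -> V) (phi : I -> {scalar V}) :
  (forall i j, phi i (b j) = (i == j)%:R) -> has_free_summand V #|I|.
Proof.
move=> phib; apply/has_free_summandP.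
exists (fun i => b (enum_val i)), (fun i => phi (enum_val i)) => i j.
by rewrite phib (inj_eq enum_val_inj).
Qed.

(** With [v] and [phi] dual families of size [n], expanding each [v j] along
    [b] and reducing by [rho] factors the identity matrix of size [n] through
    [k ^ #|I|]. *)
Lemma free_summand_le (k : fieldType) (rho : {rmorphism A -> k})
    (I : finType) (b : I -> V) (n : nat) :
  (forall x, exists c : I -> A, forall phi : {scalar V},
     rho (phi (x - \sum_i c i *: b i)) = 0) ->
  has_free_summand V n -> (n <= #|I|)%N.
Proof.
move=> span /has_free_summandP[v [phi phiv]].
have [c cP] := choice span.
pose F : 'M[k]_(n, #|I|) := \matrix_(i, l) rho (phi i (b (enum_val l))).
pose C : 'M[k]_(#|I|, n) := \matrix_(l, j) rho (c (v j) (enum_val l)).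
have FC : F *m C = 1%:M.
  apply/matrixP => i j; rewrite !mxE.
  have /eqP := cP (v j) (phi i).
  rewrite raddfB rmorphB /= phiv rmorph_nat subr_eq0 => /eqP ->.
  rewrite raddf_sum rmorph_sum /= (big_enum_val (A := I)) /=.
  by apply: eq_bigr => l _; rewrite !mxE linearZ /= rmorphM mulrC.
rewrite -(mxrank1 k n) -FC.
exact: leq_trans (mxrankM_maxl _ _) (rank_leq_col _).
Qed.
End FreeSummandCriterion.

(** * Maps that are linear for inverse Frobenius *)

(** For [q] a power of the characteristic, these are the maps which become
    linear when the source is regarded as a Frobenius push-forward. *)
Definition cartier_linear (R : nzRingType) (q : nat) (F : R -> R) :=
  (forall x y, F (x + y) = F x + F y) /\
  (forall c x, F (c ^+ q * x) = c * F x).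

Lemma cartier_linear0 (R : nzRingType) q (F : R -> R) :
  cartier_linear q F -> F 0 = 0.
Proof. by case=> FD _; apply: (addrI (F 0)); rewrite -FD !addr0. Qed.

Lemma frobenius_exprD (R : comNzRingType) p e (hp : p \in [pchar R]) (x y : R) :
  (x + y) ^+ (p ^ e) = x ^+ (p ^ e) + y ^+ (p ^ e).
Proof.
apply: exprDn_pchar; rewrite pnatX; apply/orP; left.
by rewrite pnatE ?(pcharf_prime hp).
Qed.

Section Decimation.
Variables (R : comNzRingType) (q w : nat) (F : R -> R).

Definition decimate (f : {poly R}) : {poly R} :=
  \poly_(i < size f) F f`_(q * i + w).

Lemma coef_decimate f i : (0 < q)%N -> F 0 = 0 ->
  (decimate f)`_i = F f`_(q * i + w).
Proof.
move=> q0 F0; rewrite coef_poly; case: ltnP => // le.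
by rewrite nth_default ?F0 // (leq_trans le) //; nia.
Qed.

(** Since [w < q], no exponent of the form [q * i + w] is reached from a
    negative [i]: multiplication by ['X^q] therefore becomes exactly
    multiplication by ['X]. *)
Lemma decimate_cartier p e : p \in [pchar R] -> q = (p ^ e)%N -> (w < q)%N ->
  cartier_linear q F -> cartier_linear q decimate.
Proof.
move=> hp qE wq FC; have F0 := cartier_linear0 FC; have [FD FM] := FC.
have q0 : (0 < q)%N by apply: leq_ltn_trans wq.
have cD := coef_decimate _ _ q0 F0.
have decD f g : decimate (f + g) = decimate f + decimate g.
  by apply/polyP => i; rewrite coefD !cD coefD FD.
split=> //; elim/poly_ind=> [|P c IH] f.
  rewrite expr0n gtn_eqF // !mul0r; apply/polyP => i.
  by rewrite cD !coef0.
have hpP : p \in [pchar {poly R}] by rewrite pchar_poly.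
rewrite {1}qE frobenius_exprD // -qE exprMn -polyC_exp mulrDl decD mulrDl; congr (_ + _).
  rewrite mulrAC [RHS]mulrAC -IH; apply/polyP => i.
  rewrite coefMX cD coefMXn; case: i => [|i] /=; first by rewrite muln0 add0n wq F0.
  rewrite cD ifF; last by apply/negbTE; rewrite -leqNgt; nia.
  by congr (F _`_ _); nia.
by apply/polyP => i; rewrite cD !coefCM FM cD.
Qed.
End Decimation.

Section FrobeniusBasis.
Variables (k : fieldType) (p : nat) (hp : p \in [pchar k]).

Lemma expp_sum (I : finType) (F : I -> k) : (\sum_i F i) ^+ p = \sum_i F i ^+ p.
Proof.
rewrite -(pFrobenius_autE hp) rmorph_sum.
by apply: eq_bigr => i _; rewrite /= pFrobenius_autE.
Qed.

(** Bases multiply in the tower [k^(p^(e+1)) < k^p < k]: the products of a basis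
    of [k] over [k^p] with the [p]-th powers of a basis of [k] over [k^(p^e)]. *)
Lemma frobenius_power_basis n e : frobenius_degree k p n ->
  exists (I : finType) (w : I -> k),
    [/\ #|I| = (n ^ e)%N,
        forall x, exists c : I -> k, x = \sum_i c i ^+ (p ^ e) * w i &
        forall c : I -> k, \sum_i c i ^+ (p ^ e) * w i = 0 ->
          forall i, c i = 0].
Proof.
have p0 : (0 < p)%N by rewrite prime_gt0 // (pcharf_prime hp).
move=> [w [wspan wfree]]; elim: e => [|e [I [w' [cardI span' free']]]].
  have sum1 (F : unit -> k) : \sum_i F i = F tt.
    by rewrite (bigD1 tt) //= big1 ?addr0 // => -[].
  exists unit, (fun=> 1); split=> [|x|c c0 []]; first by rewrite card_unit.
    by exists (fun=> x); rewrite sum1 mulr1 expr1.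
  by move: c0; rewrite sum1 mulr1 expn0 expr1.
exists ('I_n * I)%type, (fun ij => w' ij.2 ^+ p * w ij.1).
have sumE (c : 'I_n * I -> k) : \sum_ij c ij ^+ (p ^ e.+1) *
    (w' ij.2 ^+ p * w ij.1)
    = \sum_i (\sum_j c (i, j) ^+ (p ^ e) * w' j) ^+ p * w i.
  transitivity (\sum_i \sum_j c (i, j) ^+ (p ^ e.+1) * (w' j ^+ p * w i)).
    by rewrite pair_bigA; apply: eq_bigr => -[].
  apply: eq_bigr => i _; rewrite expp_sum mulr_suml; apply: eq_bigr => j _.
  by rewrite exprMn -exprM -expnSr mulrA.
split.
- by rewrite card_prod card_ord cardI expnS.
- move=> x; have [c ->] := wspan x.
  have [d dE] := choice (fun i => span' (c i)).
  exists (fun ij => d ij.1 ij.2); rewrite sumE.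
  by apply: eq_bigr => i _; rewrite {1}dE.
- move=> c; rewrite sumE => /wfree c0 [i j].
  have := c0 i; move/eqP; rewrite expf_eq0 p0 /= => /eqP /free'.
  exact.
Qed.

Lemma frobenius_dual_basis n e : frobenius_degree k p n ->
  exists (I : finType) (w : I -> k) (pi : I -> k -> k),
    [/\ #|I| = (n ^ e)%N, forall i, cartier_linear (p ^ e) (pi i),
        forall i j, pi i (w j) = (i == j)%:R &
        forall x, x = \sum_i pi i x ^+ (p ^ e) * w i].
Proof.
move=> /(frobenius_power_basis e)[I [w [cardI span free]]].
have [C CE] := choice span.
have uniq x c : x = \sum_i c i ^+ (p ^ e) * w i -> C x =1 c.
  move=> xE i; apply/eqP; rewrite -subr_eq0; apply/eqP; move: i.
  apply: (free (fun i => C x i - c i)).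
  have : \sum_i C x i ^+ (p ^ e) * w i = \sum_i c i ^+ (p ^ e) * w i.
    by rewrite -CE.
  move/eqP; rewrite -subr_eq0 -sumrB => /eqP sum0.
  rewrite -[RHS]sum0; apply: eq_bigr => i _.
  rewrite -mulrBl; congr (_ * _); apply: (@addIr _ (c i ^+ (p ^ e))).
  by rewrite -frobenius_exprD // !subrK.
exists I, w, (fun i x => C x i); split=> // [i|i j].
  split=> [x y|c x].
    apply: (uniq _ (fun i => C x i + C y i)); rewrite {1}(CE x) {1}(CE y).
    by rewrite -big_split; apply: eq_bigr => j _; rewrite frobenius_exprD // mulrDl.
  apply: (uniq _ (fun i => c * C x i)); rewrite {1}(CE x) mulr_sumr.
  by apply: eq_bigr => j _; rewrite exprMn mulrA.
apply: (uniq _ (fun i => (i == j)%:R)).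
rewrite (bigD1 j) //= eqxx expr1n mul1r big1 ?addr0 // => l /negPf ->.
by rewrite expr0n expn_eq0 gtn_eqF ?mul0r // prime_gt0 // (pcharf_prime hp).
Qed.
End FrobeniusBasis.

(** * Counting lattice points *)

Section Counting.
Local Open Scope nat_scope.

(** This is [max (0, q - |x - y|)], the truncated subtractions giving both the
    absolute value and the positive part. *)
Definition tent (q x y : nat) := q - ((x - y) + (y - x)).

Lemma sum_blocks (a q : nat) (F : nat -> nat) :
  \sum_(0 <= x < a * q) F x = \sum_(0 <= r < q) \sum_(0 <= i < a) F (a * r + i).
Proof.
elim: q => [|q IH]; first by rewrite muln0 !big_geq.
rewrite mulnS addnC big_nat_recr //= -IH.
rewrite (@big_cat_nat _ _ _ (a * q)) ?leq_addr //=; congr (_ + _).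
rewrite -{1}[a * q]add0n big_addn addKn.
by apply: eq_bigr => i _; rewrite addnC.
Qed.

(** The number of lattice points of the slab scaled by [q], fibred over
    [(r, s)]. *)
Definition slab_count (a b q : nat) :=
  \sum_(0 <= r < q) \sum_(0 <= s < q) tent q (a * r) (b * s).

(** The same sum over all integer points of a rectangle rather than over the
    sublattice of the [(a r, b s)]; it is the one with a closed form. *)
Definition tent_sum (q X Y : nat) :=
  \sum_(0 <= y < Y) \sum_(0 <= x < X) tent q x y.

Lemma tent_sum_blocks a b q : tent_sum q (a * q) (b * q) =
  \sum_(0 <= r < q) \sum_(0 <= s < q)
     \sum_(0 <= i < a) \sum_(0 <= j < b) tent q (a * r + i) (b * s + j).
Proof.
rewrite /tent_sum exchange_big sum_blocks; apply: eq_bigr => r _.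
rewrite [RHS]exchange_big /=; apply: eq_bigr => i _; exact: sum_blocks.
Qed.

Lemma slab_count_blocks a b q : a * b * slab_count a b q =
  \sum_(0 <= r < q) \sum_(0 <= s < q)
     \sum_(0 <= i < a) \sum_(0 <= j < b) tent q (a * r) (b * s).
Proof.
rewrite big_distrr; apply: eq_bigr => r _.
rewrite big_distrr; apply: eq_bigr => s _.
by rewrite /= sum_nat_const_nat subn0 sum_nat_const_nat subn0 mulnA.
Qed.

Lemma leq_sum4 q a b c (F G : nat -> nat -> nat -> nat -> nat) :
  (forall r s i j, i < a -> j < b -> F r s i j <= G r s i j + c) ->
  \sum_(0 <= r < q) \sum_(0 <= s < q)
     \sum_(0 <= i < a) \sum_(0 <= j < b) F r s i j <=
  \sum_(0 <= r < q) \sum_(0 <= s < q)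
     \sum_(0 <= i < a) \sum_(0 <= j < b) G r s i j + a * b * c * q ^ 2.
Proof.
move=> FG.
have -> : a * b * c * q ^ 2 = \sum_(0 <= r < q) \sum_(0 <= s < q)
     \sum_(0 <= i < a) \sum_(0 <= j < b) c.
  by rewrite !sum_nat_const_nat !subn0; lia.
rewrite -big_split; apply: leq_sum => r _.
rewrite -big_split; apply: leq_sum => s _.
rewrite -big_split big_nat [leqRHS]big_nat; apply: leq_sum => i /andP[_ ia].
rewrite -big_split big_nat [leqRHS]big_nat; apply: leq_sum => j /andP[_ jb].
exact: FG.
Qed.

(** A block [a] by [b] of integer points around [(a r, b s)] has [a * b] elements,
    and the tent function varies by at most [a + b] on it. *)
Lemma slab_count_le a b q :
  a * b * slab_count a b q <= tent_sum q (a * q) (b * q)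
    + a * b * (a + b) * q ^ 2.
Proof.
rewrite slab_count_blocks tent_sum_blocks; apply: leq_sum4 => r s i j.
by rewrite /tent; lia.
Qed.

Lemma slab_count_ge a b q :
  tent_sum q (a * q) (b * q) <=
    a * b * slab_count a b q + a * b * (a + b) * q ^ 2.
Proof.
rewrite slab_count_blocks tent_sum_blocks; apply: leq_sum4 => r s i j.
by rewrite /tent; lia.
Qed.

Definition half_tent (q m : nat) := \sum_(0 <= d < m) (q - d).

Lemma half_tentS q m : half_tent q m.+1 = half_tent q m + (q - m).
Proof. by rewrite /half_tent big_nat_recr. Qed.

Lemma half_tent_le q m : m <= q -> 2 * half_tent q m + m ^ 2 = m * (2 * q + 1).
Proof.
elim: m => [|m IH] mq; first by rewrite /half_tent big_geq.
by have := IH (ltnW mq); rewrite half_tentS; nia.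
Qed.

Lemma half_tent_ge q m : q <= m -> 2 * half_tent q m = q * q.+1.
Proof.
move=> /subnKC <-; elim: (m - q) => [|n IH].
  by have := half_tent_le (leqnn q); rewrite addn0; nia.
by rewrite addnS half_tentS mulnDr IH; nia.
Qed.

(** The row through [y] is made of two half tents which both count the summit,
    of height [q]. *)
Lemma tent_row q X y : y < X ->
  \sum_(0 <= x < X) tent q x y + q = half_tent q y.+1 + half_tent q (X - y).
Proof.
move=> yX; rewrite (@big_cat_nat _ _ _ y) //=; last exact: ltnW.
rewrite -[in X in _ + X + _](add0n y) big_addn addnAC; congr (_ + _); last first.
  by apply: eq_bigr => d _; rewrite /tent; lia.
rewrite /half_tent big_nat_recl // subn0 addnC; congr (_ + _).
rewrite big_nat_rev /= add0n big_nat [RHS]big_nat.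
by apply: eq_bigr => d /andP[_ dy]; rewrite /tent; lia.
Qed.

Definition half_tent_sum q Y := \sum_(0 <= y < Y) half_tent q y.+1.

Lemma half_tent_sum_le q Y : Y <= q ->
  12 * half_tent_sum q Y + Y * Y.+1 * (2 * Y).+1 = 3 * (2 * q).+1 * Y * Y.+1.
Proof.
elim: Y => [|Y IH] Yq; first by rewrite /half_tent_sum big_geq //; lia.
have := IH (ltnW Yq); have := half_tent_le Yq.
by rewrite /half_tent_sum big_nat_recr //=; nia.
Qed.

Lemma half_tent_sum_ge q m :
  6 * half_tent_sum q (q + m) = q * q.+1 * (2 * q).+1 + 3 * m * q * q.+1.
Proof.
elim: m => [|m IH].
  by have := half_tent_sum_le (leqnn q); rewrite addn0; nia.
have ge : q <= (q + m).+1 by lia.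
have := half_tent_ge ge.
rewrite addnS /half_tent_sum big_nat_recr //= mulnDr IH; nia.
Qed.

Lemma tent_sumE q X Y : Y <= X ->
  tent_sum q X Y + Y * q =
    half_tent_sum q Y + \sum_(0 <= y < Y) half_tent q (X - y).
Proof.
move=> YX; have <- : \sum_(0 <= y < Y) q = Y * q.
  by rewrite sum_nat_const_nat subn0.
rewrite -!big_split big_nat [RHS]big_nat; apply: eq_bigr => y /andP[_ yY].
by apply: tent_row; apply: leq_trans YX.
Qed.

(** When [b < a] every row has its right half tent complete, because
    [(b + 1) q <= a q]; only the rows with [y < q] are cut, on the left. *)
Lemma tent_sum_gt a b q : 0 < b -> b < a ->
  6 * tent_sum q (a * q) (b * q) + q ^ 3 = 6 * b * q ^ 3 + q.
Proof.
move=> b0 ba; have le : b * q <= a * q by rewrite leq_mul2r ltnW ?orbT.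
have := tent_sumE q le.
have : 2 * \sum_(0 <= y < b * q) half_tent q (a * q - y) = b * q * (q * q.+1).
  rewrite big_distrr /= -{2}[b * q]subn0 -sum_nat_const_nat.
  rewrite big_nat [RHS]big_nat; apply: eq_bigr => y /andP[_ yY].
  by apply: half_tent_ge; nia.
have := half_tent_sum_ge q ((b - 1) * q).
have -> : q + (b - 1) * q = b * q by nia.
case: b b0 {ba le} => // b _; rewrite subn1 /=.
by nia.
Qed.

(** On a square both ends are cut, and by symmetry each loses the same
    amount. *)
Lemma tent_sum_eq a q : 0 < a ->
  3 * tent_sum q (a * q) (a * q) + q ^ 3 = 3 * a * q ^ 3 + q.
Proof.
move=> a0; have := tent_sumE q (leqnn (a * q)).
have -> : \sum_(0 <= y < a * q) half_tent q (a * q - y) = half_tent_sum q (a * q).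
  rewrite big_nat_rev /= add0n /half_tent_sum big_nat [RHS]big_nat.
  by apply: eq_bigr => y /andP[_ yY]; congr half_tent; lia.
have := half_tent_sum_ge q ((a - 1) * q).
have -> : q + (a - 1) * q = a * q by nia.
case: a a0 => // a _; rewrite subn1 /=.
by nia.
Qed.
End Counting.

Section Limit.
Variable R : realType.

Lemma slab_count_bound a b (q : nat) (L : R) :
  (0 < a)%N -> (0 < b)%N -> (0 < q)%N ->
  `|(tent_sum q (a * q) (b * q))%:R - a%:R * b%:R * L * q%:R ^+ 3| <= q%:R ->
  `|(slab_count a b q)%:R / q%:R ^+ 3 - L| <= (a + b + 1)%:R / q%:R.
Proof.
move=> a0 b0 q0 Hbd.
have le1 := slab_count_le a b q; have le2 := slab_count_ge a b q.
have {le1} : ((a * b * slab_count a b q)%:R : R) <= (tent_sum q (a * q) (b * q)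
    + a * b * (a + b) * q ^ 2)%:R by rewrite ler_nat.
have {le2} : ((tent_sum q (a * q) (b * q))%:R : R) <=
    (a * b * slab_count a b q + a * b * (a + b) * q ^ 2)%:R by rewrite ler_nat.
move: Hbd; rewrite !natrD !natrM !natrD.
have A1 : 1 <= a%:R :> R by rewrite ler1n.
have B1 : 1 <= b%:R :> R by rewrite ler1n.
have Q1 : 1 <= q%:R :> R by rewrite ler1n.
move: (tent_sum _ _ _)%:R (slab_count _ _ _)%:R A1 B1 Q1.
move: a%:R b%:R q%:R => A B Q T N A1 B1 Q1 /ler_normlP[h1 h2] h3 h4.
have Q0 : 0 < Q by lra.
have AB : 1 <= A * B by nra.
have QQ : Q <= Q ^+ 2 by nra.
have key : `|N - L * Q ^+ 3| <= (A + B + 1) * Q ^+ 2.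
  rewrite -(ler_pM2l (x := A * B)); last lra.
  rewrite -{1}[A * B]ger0_norm -?normrM; last lra.
  apply/ler_normlP; split; nra.
rewrite -(ler_pM2r (x := Q ^+ 3)) ?exprn_gt0 //.
have -> : (A + B + 1) / Q * Q ^+ 3 = (A + B + 1) * Q ^+ 2 by field; lra.
rewrite -{2}[Q ^+ 3]ger0_norm -?normrM ?exprn_ge0 ?(ltW Q0) //.
by rewrite mulrBl divfK // expf_neq0 // gt_eqF.
Qed.

(** The error [O(q ^ 2)] of the block comparison disappears after division by
    [q ^ 3]. *)
Lemma slab_count_cvg a b p (L : R) :
  (0 < a)%N -> (0 < b)%N -> (1 < p)%N ->
  (forall q, `|(tent_sum q (a * q) (b * q))%:R - a%:R * b%:R * L * q%:R ^+ 3|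
     <= q%:R) ->
  (fun e : nat => (slab_count a b (p ^ e))%:R / (p ^ e)%:R ^+ 3) @ \oo --> L.
Proof.
move=> a0 b0 p1 Hbd.
pose g := @geometric R (a + b + 1)%:R p%:R^-1.
have g0 : g x @[x --> \oo] --> (0 : R).
  apply: cvg_geometric; rewrite ger0_norm ?invr_ge0 //.
  by rewrite invf_lt1 ?ltr1n // ltr0n; apply: ltn_trans p1.
apply: (@squeeze_cvgr _ _ _ _ (fun e => L - g e) (fun e => L + g e)).
- apply: nearW => e; rewrite -ler_distl.
  have -> : g e = (a + b + 1)%:R / (p ^ e)%:R.
    by rewrite /g /geometric /= natrX exprVn.
  apply: slab_count_bound => //.
  by rewrite expn_gt0 (ltn_trans _ p1).
- by rewrite -[X in _ --> X]subr0; apply: cvgB g0; apply: cvg_cst.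
- by rewrite -[X in _ --> X]addr0; apply: cvgD g0; apply: cvg_cst.
Qed.

Lemma tent_sum_gt_bound a b q : (0 < b)%N -> (b < a)%N ->
  `|(tent_sum q (a * q) (b * q))%:R - a%:R * b%:R *
     ((6 * b%:R - 1) / (6 * a%:R * b%:R)) * q%:R ^+ 3| <= q%:R :> R.
Proof.
move=> b0 ba; have := tent_sum_gt q b0 ba.
move/(congr1 (fun n : nat => n%:R : R)); rewrite !(natrD, natrM, natrX).
have A0 : (a%:R : R) != 0 by rewrite pnatr_eq0 -lt0n (leq_ltn_trans _ ba).
have B0 : (b%:R : R) != 0 by rewrite pnatr_eq0 -lt0n.
have Q0 : 0 <= q%:R :> R by [].
move: (tent_sum _ _ _)%:R A0 B0 Q0.
move: a%:R b%:R q%:R => A B Q T A0 B0 Q0 TE.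
have -> : A * B * ((6 * B - 1) / (6 * A * B)) * Q ^+ 3 = T - Q / 6.
  have -> : T = (6 * B * Q ^+ 3 + Q - Q ^+ 3) / 6 by lra.
  by field; rewrite A0 B0.
by rewrite opprB addrC subrK ger0_norm; lra.
Qed.

Lemma tent_sum_eq_bound a q : (0 < a)%N ->
  `|(tent_sum q (a * q) (a * q))%:R - a%:R * a%:R *
     ((3 * a%:R - 1) / (3 * a%:R ^+ 2)) * q%:R ^+ 3| <= q%:R :> R.
Proof.
move=> a0; have := tent_sum_eq q a0.
move/(congr1 (fun n : nat => n%:R : R)); rewrite !(natrD, natrM, natrX).
have A0 : (a%:R : R) != 0 by rewrite pnatr_eq0 -lt0n.
have Q0 : 0 <= q%:R :> R by [].
move: (tent_sum _ _ _)%:R A0 Q0.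
move: a%:R q%:R => A Q T A0 Q0 TE.
have -> : A * A * ((3 * A - 1) / (3 * A ^+ 2)) * Q ^+ 3 = T - Q / 3.
  have -> : T = (3 * A * Q ^+ 3 + Q - Q ^+ 3) / 3 by lra.
  by field; rewrite A0.
by rewrite opprB addrC subrK ger0_norm; lra.
Qed.

Lemma powR_frobenius (p n : nat) (e : nat) (alpha : R) : (0 < p)%N ->
  p%:R `^ alpha = n%:R ->
  p%:R `^ (e%:R * (3%:R + alpha)) = (p ^ e)%:R ^+ 3 * (n ^ e)%:R.
Proof.
move=> p0 pn; rewrite mulrC powRrM powRD; last first.
  by apply/implyP => _; rewrite pnatr_eq0 -lt0n.
rewrite pn !powR_mulrn ?mulr_ge0 ?exprn_ge0 // exprMn !natrX.
by rewrite -!exprM mulnC.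
Qed.
End Limit.

(** * An upper bound for the Krull dimension *)

Section Peeling.
Variables (A : nzRingType) (B : comNzRingType) (E : {rmorphism A -> B}).
Variables (P P' : set B) (y : B).
Hypotheses (Pprime : is_prime_ideal P) (P'ideal : is_ideal P').
Hypotheses (PP' : P `<=` P') (yP' : P' y) (yP : ~ P y).

(** Divide a relation by the largest possible power of [y], which is harmless
    modulo [P] as [y] is not in [P]; what remains is a nonzero constant term
    plus a multiple of [y], and [y] belongs to [P']. *)
Lemma prime_peel (Q : {poly A}) : Q != 0 -> P (map_poly E Q).[y] ->
  exists2 c, c != 0 & P' (E c).
Proof.
elim/poly_ind: Q => [|Q c IH]; first by rewrite eqxx.
have [->|c0] := eqVneq c 0.
  rewrite polyC0 addr0 => QX.
  have Q0 : Q != 0 by apply: contraNneq QX => ->; rewrite mul0r.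
  rewrite rmorphM /= map_polyX hornerMX => Py.
  have [_ _ /(_ _ _ Py)[|//]] := Pprime; exact: IH.
move=> _; rewrite rmorphD rmorphM /= map_polyX map_polyC hornerMXaddC => PQ.
exists c => //; have [_ P'D P'M] := P'ideal.
have -> : E c = (map_poly E Q).[y] * y + E c - (map_poly E Q).[y] * y.
  by rewrite addrC addKr.
by apply: P'D; [exact: PP' | rewrite -mulNr; apply: P'M].
Qed.
End Peeling.

Section EvalMorphism.
Variables (A : comNzRingType) (B : comNzRingType) (E : {rmorphism A -> B}).
Variable (y : B).
Lemma eval_morphism : exists G : {rmorphism {poly A} -> B},
  forall Q, G Q = (map_poly E Q).[y].
Proof.
have cE : commr_rmorph E y by move=> c; apply: mulrC.
by exists (horner_morph cE).
Qed.
End EvalMorphism.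

Section Dependence.
Variables (k : fieldType).
Local Notation T := {poly {poly {poly k}}}.

Definition deg_le (D : nat) (f : T) := forall s r t,
  [|| (D < s)%N, (D < r)%N | (D < t)%N] -> f`_s`_r`_t = 0.

Lemma coef3M (f g : T) s r t : (f * g)`_s`_r`_t =
  \sum_(i < s.+1) \sum_(j < r.+1) \sum_(l < t.+1)
    f`_i`_j`_l * g`_(s - i)`_(r - j)`_(t - l).
Proof.
rewrite coefM !coef_sum; apply: eq_bigr => i _.
rewrite coefM coef_sum; apply: eq_bigr => j _.
by rewrite coefM.
Qed.

Lemma deg_leM D D' f g : deg_le D f -> deg_le D' g -> deg_le (D + D') (f * g).
Proof.
move=> fD gD s r t H; rewrite coef3M.
rewrite big1 // => i _; rewrite big1 // => j _; rewrite big1 // => l _.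
have := ltn_ord i; have := ltn_ord j; have := ltn_ord l => hl hj hi.
have [fi|/negbTE ni] := boolP [|| (D < i)%N, (D < j)%N | (D < l)%N].
  by rewrite fD // mul0r.
by rewrite gD ?mulr0 //; lia.
Qed.

Lemma deg_le1 : deg_le 0 1.
Proof.
move=> s r t; rewrite coef1; case: s => [|s]; last by rewrite !coef0.
rewrite coef1; case: r => [|r]; last by rewrite coef0.
by rewrite coef1; case: t.
Qed.

Lemma deg_leX D f n : deg_le D f -> deg_le (n * D) (f ^+ n).
Proof.
move=> fD; elim: n => [|n IH]; first exact: deg_le1.
by rewrite exprS mulSn; apply: deg_leM.
Qed.

Lemma deg_leW D D' f : (D <= D')%N -> deg_le D f -> deg_le D' f.
Proof. by move=> DD fD s r t H; apply: fD; lia. Qed.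

Lemma deg_le_exists f : exists D, deg_le D f.
Proof.
exists (size f + \sum_(s < size f)
  (size (f`_s)%R + \sum_(r < size (f`_s)%R) size (f`_s`_r)%R))%N.
move=> s r t H.
have [sf|sf] := leqP (size f) s; first by rewrite (nth_default _ sf) !coef0.
move: H; rewrite (bigD1 (Ordinal sf)) //=.
have [rf|rf] := leqP (size f`_s) r; first by rewrite (nth_default _ rf) !coef0.
rewrite (bigD1 (Ordinal rf)) //=.
move: (\sum_(_ < _ | _) _)%N => m1; move: (\sum_(_ < _ | _) _)%N => m2 H.
apply: nth_default; move: (size _) (size _) (size _) sf rf H => n1 n2 n3; lia.
Qed.

Lemma linear_dependent (I : finType) (y : I -> T) D :
  (forall i, deg_le D (y i)) -> (D.+1 ^ 3 < #|I|)%N ->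
  exists2 c : I -> k, (exists i, c i != 0) &
    \sum_i (c i)%:P%:P%:P * y i = 0.
Proof.
move=> yD cardI; pose J : finType := ('I_D.+1 * 'I_D.+1 * 'I_D.+1)%type.
pose M : 'M[k]_(#|I|, #|J|) := \matrix_(i, j)
  let w : 'I_D.+1 * 'I_D.+1 * 'I_D.+1 := enum_val j in
  (y (enum_val i))`_w.1.1`_w.1.2`_w.2.
have : kermx M != 0.
  rewrite kermx_eq0 /row_free neq_ltn (leq_ltn_trans (rank_leq_col _)) //.
  by rewrite !card_prod !card_ord; move: cardI; rewrite !expnS expn0; lia.
case/rowV0Pn=> v /sub_kermxP vM v0.
exists (fun i => v 0 (enum_rank i)).
  have /existsP[i vi] : [exists i, v 0 i != 0].
    apply: contraNT v0; rewrite negb_exists => /forallP v0.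
    by apply/eqP/rowP => i; rewrite mxE; apply/eqP; have := v0 i; rewrite negbK.
  by exists (enum_val i); rewrite enum_valK.
apply/polyP => s; apply/polyP => r; apply/polyP => t; rewrite coef0 !coef0.
rewrite !coef_sum.
under eq_bigr do rewrite !coefCM.
have [/orP H|H] := boolP [|| (D < s)%N, (D < r)%N | (D < t)%N].
  by rewrite big1 // => i _; rewrite yD ?mulr0 //; apply/orP.
move: H; rewrite !negb_or -!leqNgt => /and3P[sD rD tD].
pose j : J := (@Ordinal D.+1 s sD, @Ordinal D.+1 r rD, @Ordinal D.+1 t tD).
have /matrixP/(_ 0 (enum_rank j)) := vM; rewrite !mxE => vM0.
rewrite -[RHS]vM0 (big_enum_val (A := I)) /=; apply: eq_bigr => i _.
by rewrite mxE enum_rankK enum_valK.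
Qed.
End Dependence.

Section KrullBound.
Variables (k : fieldType) (B : comNzRingType) (E : {rmorphism k -> B}).
Variable h : {rmorphism B -> {poly {poly {poly k}}}}.
Hypotheses (h_inj : injective h) (hE : forall c, h (E c) = c%:P%:P%:P).

(** There are [N ^ 4] products of powers of the [y_i] with exponents below [N],
    and they lie in a space of polynomials of dimension [(N * D) ^ 3], where [D]
    depends only on the [y_i]; the choice [N = D ^ 3 + 1] makes the former number
    the larger. *)
Lemma algebraic_relation (y0 y1 y2 y3 : B) :
  exists N (c : 'I_N * 'I_N * 'I_N * 'I_N -> k), (exists i, c i != 0) /\
    \sum_i E (c i) * (y3 ^+ i.2 * y2 ^+ i.1.2 * y1 ^+ i.1.1.2
      * y0 ^+ i.1.1.1) = 0.
Proof.
have [D0 d0] := deg_le_exists (h y0); have [D1 d1] := deg_le_exists (h y1).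
have [D2 d2] := deg_le_exists (h y2); have [D3 d3] := deg_le_exists (h y3).
have [D DE] : exists D, D = (D0 + D1 + D2 + D3).+1%N.
  by exists (D0 + D1 + D2 + D3).+1%N.
have [N NE] : exists N, N = (D ^ 3).+1%N by exists (D ^ 3).+1%N.
pose I : finType := ('I_N * 'I_N * 'I_N * 'I_N)%type.
pose Y (i : I) := y3 ^+ i.2 * y2 ^+ i.1.2 * y1 ^+ i.1.1.2 * y0 ^+ i.1.1.1.
have YD i : deg_le (N * D).-1 (h (Y i)).
  move: i => [[[i j] l] m]; rewrite /Y !rmorphM !rmorphXn /=.
  apply: (@deg_leW k (m * D3 + l * D2 + j * D1 + i * D0)).
    have le_mul (u v : nat) : (u < N)%N -> (u * v <= N * v)%N.
      by move=> uN; rewrite leq_mul2r ltnW ?orbT.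
    have N0 : (0 < N)%N by rewrite NE.
    have := le_mul _ D0 (ltn_ord i); have := le_mul _ D1 (ltn_ord j).
    have := le_mul _ D2 (ltn_ord l); have := le_mul _ D3 (ltn_ord m).
    rewrite DE mulnS !mulnDr; move: (m * _)%N (l * _)%N (j * _)%N (i * _)%N.
    move: (N * D0)%N (N * D1)%N (N * D2)%N (N * D3)%N => v0 v1 v2 v3.
    by move=> u1 u2 u3 u4; lia.
  by do ![apply: deg_leM | exact: deg_leX].
have [|c c0 cY] := linear_dependent YD.
  rewrite !card_prod !card_ord prednK; last by rewrite NE DE.
  have -> : (N * N * N * N = N ^ 3 * N)%N by rewrite !expnS expn0 muln1 !mulnA.
  by rewrite expnMn ltn_pmul2l ?expn_gt0 ?NE.
exists N, c; split=> //; apply: h_inj; rewrite rmorph0 -[RHS]cY rmorph_sum.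
by apply: eq_bigr => i _; rewrite rmorphM /= hE.
Qed.

(** A relation between elements [y i] of [P i.+1] outside [P i], peeled four
    times, leaves a nonzero scalar, hence a unit, in [P 4]. *)
Theorem prime_chain_bound n : has_prime_chain B n -> (n <= 3)%N.
Proof.
move=> [P [Pprime Pchain]]; rewrite leqNgt; apply/negP => n3.
have sub i : (i < 4)%N -> P i `<=` P i.+1.
  by move=> i4; have [] := Pchain i (leq_trans i4 n3).
have elt i : (i < 4)%N -> exists2 y, P i.+1 y & ~ P i y.
  move=> i4; have [_ /existsNP[y /not_implyP[? ?]]] := Pchain i (leq_trans i4 n3).
  by exists y.
have prm i : (i < 5)%N -> is_prime_ideal (P i).
  by move=> i5; apply: Pprime; apply: leq_trans n3.
have idl i : (i < 5)%N -> is_ideal (P i) by move/prm => [].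
have [y0 y0P y0N] := elt 0%N isT; have [y1 y1P y1N] := elt 1%N isT.
have [y2 y2P y2N] := elt 2%N isT; have [y3 y3P y3N] := elt 3%N isT.
have [G1 G1E] := eval_morphism E y3; have [G2 G2E] := eval_morphism G1 y2.
have [G3 G3E] := eval_morphism G2 y1; have [G4 G4E] := eval_morphism G3 y0.
have [N [c [[i0 ci0] cY]]] := algebraic_relation y0 y1 y2 y3.
(* The variable of outermost nesting stands for [y0], that of the smallest
   prime, so that peeling follows the chain upwards. *)
pose mon (i : 'I_N * 'I_N * 'I_N * 'I_N) :
    {poly {poly {poly {poly k}}}} :=
  (((c i *: 'X^(i.2)) *: 'X^(i.1.2)) *: 'X^(i.1.1.2)) *: 'X^(i.1.1.1).
pose Q := \sum_i mon i.
have GX (A0 : comNzRingType) (F : {rmorphism A0 -> B})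
    (G : {rmorphism {poly A0} -> B}) y z m :
    (forall Q, G Q = (map_poly F Q).[y]) -> G (z *: 'X^m) = F z * y ^+ m.
  move=> GE; rewrite GE -mul_polyC rmorphM /= map_polyC map_polyXn.
  by rewrite hornerM hornerC hornerXn.
have Q0 : Q != 0.
  apply: contraNneq ci0 => /(congr1 (fun q : {poly {poly {poly {poly k}}}} =>
    q`_i0.1.1.1`_i0.1.1.2`_i0.1.2`_i0.2)); rewrite !coef0 !coef_sum => sum0.
  apply/eqP; rewrite -[RHS]sum0.
  rewrite (bigD1 i0) //= big1.
    by rewrite addr0 /mon !(coefZ, coefXn, eqxx, mulr1).
  move=> i ii0; rewrite /mon; apply: contraNeq ii0.
  rewrite coefZ coefXn; case: (nat_of_ord i0.1.1.1 =P i.1.1.1) => [e0|_];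
    last by rewrite mulr0 !coef0 eqxx.
  rewrite mulr1 coefZ coefXn; case: (nat_of_ord i0.1.1.2 =P i.1.1.2) => [e1|_];
    last by rewrite mulr0 !coef0 eqxx.
  rewrite mulr1 coefZ coefXn; case: (nat_of_ord i0.1.2 =P i.1.2) => [e2|_];
    last by rewrite mulr0 !coef0 eqxx.
  rewrite mulr1 coefZ coefXn; case: (nat_of_ord i0.2 =P i.2) => [e3|_];
    last by rewrite mulr0 eqxx.
  move=> _; move: i i0 e0 e1 e2 e3 {sum0} => [[[i j] l] m] [[[i' j'] l'] m'] /=.
  by move=> /val_inj -> /val_inj -> /val_inj -> /val_inj ->.
have P0Q : P 0%N (map_poly G3 Q).[y0].
  rewrite -G4E rmorph_sum; set S := (X in P _ X).
  suff -> : S = 0 by case: (idl 0%N isT).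
  rewrite -[RHS]cY; apply: eq_bigr => i _ /=.
  by rewrite (GX _ _ _ _ _ _ G4E) (GX _ _ _ _ _ _ G3E) (GX _ _ _ _ _ _ G2E)
    (GX _ _ _ _ _ _ G1E) !mulrA.
have [q3 q30] := prime_peel (prm 0%N isT) (idl 1%N isT) (sub 0%N isT)
  y0P y0N Q0 P0Q.
rewrite G3E => Pq3.
have [q2 q20] := prime_peel (prm 1%N isT) (idl 2%N isT) (sub 1%N isT)
  y1P y1N q30 Pq3.
rewrite G2E => Pq2.
have [q1 q10] := prime_peel (prm 2%N isT) (idl 3%N isT) (sub 2%N isT)
  y2P y2N q20 Pq2.
rewrite G1E => Pq1.
have [q0 q00] := prime_peel (prm 3%N isT) (idl 4%N isT) (sub 3%N isT)
  y3P y3N q10 Pq1.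
have [[_ _ PM] P1 _] := prm 4%N isT.
by move/(PM (E q0^-1)); rewrite -rmorphM mulVf // rmorph1.
Qed.
End KrullBound.

(** * The intersection algebra as a semigroup ring *)

Section SemigroupRing.
Variables (k : fieldType) (a b : nat).
Local Notation T := {poly {poly {poly k}}}.
Local Notation B := (Balg k a b).

Definition in_cone (r s t : nat) := (a * r <= t)%N && (b * s <= t)%N.

Definition cone_supported (f : T) :=
  forall r s t, f`_s`_r`_t != 0 -> in_cone r s t.

Lemma ideal_powXP c n (f : {poly k}) :
  ideal_pow (ideal_gen [set 'X^c]) n f <->
  forall t, f`_t != 0 -> (c * n <= t)%N.
Proof.
split.
  move=> /ideal_pow_principal[g ->] t; rewrite -exprM coefMXn.
  by case: ltnP => //; rewrite eqxx.
move=> fE; apply/ideal_pow_principal.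
exists (\poly_(i < size f) f`_(i + c * n)); rewrite -exprM; apply/polyP => t.
rewrite coefMXn; case: ltnP => [ltt|let_].
  by apply/eqP; apply: contraTT ltt => /fE; rewrite -leqNgt.
rewrite coef_poly subnK //; case: ltnP => // sz.
by rewrite nth_default // (leq_trans sz) // leq_subr.
Qed.

Lemma BalgP (f : T) : reflect (cone_supported f)
  (f \in intersection_algebra_pred (ideal_gen [set 'X^a]) (ideal_gen [set 'X^b])).
Proof.
apply: (iffP idP) => [/asboolP fE r s t nz|fE]; last apply/asboolP => r s.
  by have [/ideal_powXP/(_ _ nz) ra /ideal_powXP/(_ _ nz) sb] := fE r s; apply/andP.
by split; apply/ideal_powXP => t /fE/andP[].
Qed.

Lemma Balg_supported (f : B) : cone_supported (ia_val f).
Proof. exact/BalgP/ia_valP. Qed.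

Lemma coef_term c r s t i j l : (c%:P%:P%:P * monomial k r s t)`_i`_j`_l
  = if (l == t) && (j == r) && (i == s) then c else 0.
Proof.
by rewrite !coefCM coef_monomial; case: ifP; rewrite ?mulr1 ?mulr0.
Qed.

Definition to_Balg (f : T) : B := insubd (0 : B) f.

Lemma to_BalgK f : cone_supported f -> ia_val (to_Balg f) = f.
Proof. by move=> /BalgP fE; exact: insubdK. Qed.

Definition term c r s t : B := to_Balg (c%:P%:P%:P * monomial k r s t).

Lemma val_term c r s t : in_cone r s t ->
  ia_val (term c r s t) = c%:P%:P%:P * monomial k r s t.
Proof.
move=> zS; apply: to_BalgK => j i l; rewrite coef_term.
by case: ifP => [/andP[/andP[/eqP-> /eqP->] /eqP->]|]; rewrite ?eqxx.
Qed.

Lemma monomialM r s t r' s' t' : monomial k r s t * monomial k r' s' t' =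
  monomial k (r + r') (s + s') (t + t').
Proof. by rewrite /monomial !exprD -!mul_polyC !rmorphM /=; ring. Qed.

Lemma monomialX r s t n : monomial k r s t ^+ n = monomial k (n * r) (n * s) (n * t).
Proof.
elim: n => [|n IH]; first by rewrite !mul0n /monomial !expr0 !scale1r.
by rewrite exprS IH monomialM !mulSn.
Qed.

Lemma in_coneD r s t r' s' t' : in_cone r s t -> in_cone r' s' t' ->
  in_cone (r + r') (s + s') (t + t').
Proof. by rewrite /in_cone; nia. Qed.

Lemma in_coneM r s t n : in_cone r s t -> in_cone (n * r) (n * s) (n * t).
Proof. by rewrite /in_cone; nia. Qed.

Lemma termM c d r s t r' s' t' : in_cone r s t -> in_cone r' s' t' ->
  term c r s t * term d r' s' t' = term (c * d) (r + r') (s + s') (t + t').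
Proof.
move=> z1 z2; apply: val_inj; rewrite /= !val_term ?in_coneD //.
by rewrite mulrACA monomialM !polyCM.
Qed.

Lemma termX c r s t n : in_cone r s t ->
  term c r s t ^+ n = term (c ^+ n) (n * r) (n * s) (n * t).
Proof.
move=> z1; apply: val_inj; rewrite rmorphXn /= !val_term ?in_coneM //.
by rewrite exprMn monomialX !polyC_exp.
Qed.

Lemma in_cone0 t : in_cone 0 0 t.
Proof. by rewrite /in_cone !muln0. Qed.

Definition scalar_elt c : B := term c 0 0 0.

Lemma val_scalar_elt c : ia_val (scalar_elt c) = c%:P%:P%:P.
Proof. by rewrite val_term ?in_cone0 // /monomial !expr0 !scale1r mulr1. Qed.

(** Bundled as one morphism, from which the ring laws of iterated constants are
    read off. *)
Definition polyC3 : k -> T := polyC \o (polyC \o polyC).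
HB.instance Definition _ := GRing.RMorphism.on polyC3.

Lemma scalar_elt_is_zmod_morphism : zmod_morphism scalar_elt.
Proof.
move=> c d; apply: val_inj.
have E1 : ia_val (scalar_elt (c - d)) = polyC3 (c - d) := val_scalar_elt _.
have E2 : ia_val (scalar_elt c) = polyC3 c := val_scalar_elt _.
have E3 : ia_val (scalar_elt d) = polyC3 d := val_scalar_elt _.
have E4 := rmorphB polyC3 c d.
apply: (etrans E1).
apply: (etrans E4).
exact: (congr2 (fun x y : T => x - y) (esym E2) (esym E3)).
Qed.

Lemma scalar_elt_is_monoid_morphism : monoid_morphism scalar_elt.
Proof.
split=> [|c d]; apply: val_inj.
  apply: (etrans (val_scalar_elt 1)).
  apply: (etrans (rmorph1 polyC3)).
  reflexivity.
apply: (etrans (val_scalar_elt (c * d))).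
apply: (etrans (rmorphM polyC3 c d)).
have E2 : ia_val (scalar_elt c) = polyC3 c := val_scalar_elt _.
have E3 : ia_val (scalar_elt d) = polyC3 d := val_scalar_elt _.
exact: (congr2 (fun x y : T => x * y) (esym E2) (esym E3)).
Qed.

Lemma val_term1 r s t : in_cone r s t -> ia_val (term 1 r s t) = monomial k r s t.
Proof.
move=> z; apply: (etrans (val_term _ z)).
have e1 : polyC3 1 = 1 := rmorph1 polyC3.
exact: (etrans (congr1 (fun u : T => u * monomial k r s t) e1) (mul1r _)).
Qed.

HB.instance Definition _ := GRing.isZmodMorphism.Build k B scalar_elt
  scalar_elt_is_zmod_morphism.
HB.instance Definition _ := GRing.isMonoidMorphism.Build k B scalar_elt
  scalar_elt_is_monoid_morphism.

Lemma polynomial_term_ind (Q : T -> Prop) :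
  Q 0 -> (forall f g, Q f -> Q g -> Q (f + g)) ->
  forall f : T, (forall r s t, f`_s`_r`_t != 0 ->
     Q ((f`_s`_r`_t)%:P%:P%:P * monomial k r s t)) -> Q f.
Proof.
move=> Q0 QD f Qf.
have -> : f = \sum_(s < size f) \sum_(r < size f`_s) \sum_(t < size f`_s`_r)
      (f`_s`_r`_t)%:P%:P%:P * monomial k r s t.
  rewrite -[LHS]coefK poly_def; apply: eq_bigr => s _.
  rewrite -[X in X *: _]coefK poly_def scaler_suml; apply: eq_bigr => r _.
  rewrite -[X in (X *: _) *: _]coefK poly_def !scaler_suml.
  apply: eq_bigr => t _; rewrite /monomial -!mul_polyC !rmorphM /=.
  by rewrite !mulrA.
apply: big_ind => // s _; apply: big_ind => // r _; apply: big_ind => // t _.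
have [->|nz] := eqVneq f`_s`_r`_t 0; first by rewrite !polyC0 mul0r.
exact: Qf.
Qed.

(** An element of a semigroup ring is the sum of its terms, and each of them lies
    in the ring. *)
Lemma Balg_ind (Q : B -> Prop) :
  Q 0 -> (forall f g, Q f -> Q g -> Q (f + g)) ->
  forall f : B, (forall r s t, (ia_val f)`_s`_r`_t != 0 ->
     Q (term (ia_val f)`_s`_r`_t r s t)) -> Q f.
Proof.
move=> Q0 QD f Qf.
suff [g Qg /val_inj <-] : exists2 g : B, Q g & ia_val g = ia_val f by [].
apply: (polynomial_term_ind (Q := fun h => exists2 g : B, Q g & ia_val g = h)).
- by exists 0.
- by move=> _ _ [g Qg <-] [h Qh <-]; exists (g + h) => //; apply: QD.
- move=> r s t nz; exists (term (ia_val f)`_s`_r`_t r s t); first exact: Qf.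
  by rewrite val_term //; apply: Balg_supported nz.
Qed.

End SemigroupRing.

(** * The Krull dimension is 3 *)

Lemma kernel_prime (B : comNzRingType) (D : idomainType) (g : B -> D) :
  {morph g : x y / x + y} -> {morph g : x y / x * y} -> g 1 = 1 ->
  is_prime_ideal [set f | g f = 0].
Proof.
move=> gD gM g1; split=> /=.
- split=> /= [|x y x0 y0|c x x0]; last by rewrite gM x0 mulr0.
    by apply: (addrI (g 0)); rewrite -gD !addr0.
  by rewrite gD x0 y0 addr0.
- by rewrite g1; apply/eqP; apply: oner_neq0.
- move=> x y; rewrite gM => /eqP.
  by rewrite mulf_eq0 => /orP[]/eqP; [left|right].
Qed.

Section Krull.
Variables (k : fieldType) (a b : nat).
Local Notation B := (Balg k a b).

(** The kernels of the identity and of the evaluations at [u = 0], at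
    [u = v = 0] and at [u = v = x = 0]; they are the primes attached to a flag of
    faces of the cone. *)
Definition face (i : nat) : set B :=
  match i with
  | 0 => [set 0]
  | 1 => [set f : B | forall s, (ia_val f)`_s`_0 = 0]
  | 2 => [set f : B | (ia_val f)`_0`_0 = 0]
  | _ => [set f : B | (ia_val f)`_0`_0`_0 = 0]
  end.

Lemma face_prime i : is_prime_ideal (face i).
Proof.
case: i => [|[|[|i]]] /=.
- rewrite (_ : [set 0] = [set f : B | ia_val f = 0]); first exact: kernel_prime.
  by apply/seteqP; split=> f /= [f0]; [rewrite f0 | apply: val_inj].
- pose g : {rmorphism B -> {poly {poly k}}} :=
    map_poly (horner_eval 0) \o (val : B -> {poly {poly {poly k}}}).
  have gE f s : (g f)`_s = (ia_val f)`_s`_0.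
    by rewrite /g /= coef_map /= /horner_eval horner_coef0.
  rewrite (_ : [set _ | _] = [set f : B | g f = 0]).
    by apply: kernel_prime; [exact: rmorphD | exact: rmorphM | exact: rmorph1].
  apply/seteqP; split=> f /= f0; first by apply/polyP => s; rewrite gE f0 coef0.
  by move=> s; rewrite -gE (f0 : g f = 0) coef0.
- by apply: kernel_prime => [f h|f h|] /=; rewrite ?coefD ?coef0M ?coef1.
- by apply: kernel_prime => [f h|f h|] /=; rewrite ?coefD ?coef0M ?coef1.
Qed.

Lemma face_chain i : (i < 3)%N -> face i `<` face i.+1.
Proof.
have term_coef r s t r' s' t' : in_cone a b r s t ->
    (ia_val (term a b (1 : k) r s t))`_s'`_r'`_t' =
    if (t' == t) && (r' == r) && (s' == s) then 1 else 0.
  by move=> zS; rewrite val_term // coef_term.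
have term_coef0 r s t r' s' : in_cone a b r s t -> (r' != r) || (s' != s) ->
    (ia_val (term a b (1 : k) r s t))`_s'`_r' = 0.
  move=> zS ne; apply/polyP => l; rewrite term_coef // coef0 ifF //.
  by case: eqP ne; case: eqP; rewrite ?andbF.
have nz r s t : in_cone a b r s t ->
    (ia_val (term a b (1 : k) r s t))`_s`_r`_t != 0.
  by move=> zS; rewrite term_coef // !eqxx oner_neq0.
case: i => [|[|[|//]]] _; split=> /=.
- by move=> f -> s; rewrite !coef0.
- move=> sub; have zS : in_cone a b 1 0 a by rewrite /in_cone; lia.
  have /sub f0 : face 1 (term a b (1 : k) 1 0 a).
    by move=> s; rewrite term_coef0.
  by have := nz _ _ _ zS; rewrite f0 /= !coef0 eqxx.
- by move=> f f0; exact: (f0 0%N).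
- move=> sub; have zS : in_cone a b 0 1 b by rewrite /in_cone; lia.
  have /sub f0 : face 2 (term a b (1 : k) 0 1 b).
    by rewrite /= term_coef0.
  by have := nz _ _ _ zS; rewrite (f0 1%N) coef0 eqxx.
- by move=> f /= ->; rewrite coef0.
- move=> sub; have zS : in_cone a b 0 0 1 by rewrite /in_cone; lia.
  have /sub f0 : face 3 (term a b (1 : k) 0 0 1).
    by rewrite /= term_coef.
  by have := nz _ _ _ zS; rewrite f0 coef0 eqxx.
Qed.

Lemma Balg_krull_dim : krull_dim B 3.
Proof.
split.
  by exists face; split=> i i3; [exact: face_prime | exact: face_chain].
exact: (@prime_chain_bound k B (@scalar_elt k a b) val val_inj
  (@val_scalar_elt k a b)).
Qed.
End Krull.

(** * The localization and its Frobenius push-forward *)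

Section Localization.
Variables (k : fieldType) (a b : nat).
Local Notation B := (Balg k a b).
Local Notation A := (Bloc k a b).

Definition const_coef (f : B) : k := (ia_val f)`_0`_0`_0.

Lemma const_coefM f g : const_coef (f * g) = const_coef f * const_coef g.
Proof. by rewrite /const_coef /= !coef0M. Qed.

Lemma const_coefD f g : const_coef (f + g) = const_coef f + const_coef g.
Proof. by rewrite /const_coef /= !coefD. Qed.

Lemma const_coef1 : const_coef 1 = 1.
Proof. by rewrite /const_coef /= !coef1. Qed.

Lemma const_coefX f n : const_coef (f ^+ n) = const_coef f ^+ n.
Proof. by elim: n => [|n IH]; rewrite ?const_coef1 // !exprS const_coefM IH. Qed.

Definition Bfrac (f g : B) : A :=
  insubd (0 : A) (tofrac (ia_val f) / tofrac (ia_val g)).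

Lemma fracE f g : const_coef g != 0 ->
  bloc_val (Bfrac f g) = tofrac (ia_val f) / tofrac (ia_val g).
Proof.
move=> g0; apply: insubdK; apply/asboolP; exists f, g; split=> //.
by move/BmaxE/eqP; apply/negP.
Qed.

Lemma tofrac_neq0 g : const_coef g != 0 -> tofrac (ia_val g) != 0.
Proof.
rewrite tofrac_eq0; apply: contraNneq => g0.
by rewrite /const_coef g0 !coef0.
Qed.

Lemma BlocE (z : A) : exists f g, const_coef g != 0 /\ z = Bfrac f g.
Proof.
have /asboolP[f [g [gm zE]]] := bloc_valP z.
have g0 : const_coef g != 0 by apply/eqP => /BmaxE.
by exists f, g; split=> //; apply: val_inj; rewrite /= fracE.
Qed.

Lemma eq_frac f g f' g' : const_coef g != 0 -> const_coef g' != 0 ->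
  Bfrac f g = Bfrac f' g' <-> f * g' = f' * g.
Proof.
move=> g0 g0'; have n0 := tofrac_neq0 g0; have n0' := tofrac_neq0 g0'.
have mE (x y : B) : tofrac (ia_val (x * y)) = tofrac (ia_val x) * tofrac (ia_val y).
  exact: tofracM.
have e1 := fracE f g0; have e2 := fracE f' g0'.
have e3 := eqr_div (tofrac (ia_val f)) (tofrac (ia_val f')) n0 n0'.
split=> e.
  apply: val_inj; apply/eqP; rewrite -[_ == _]tofrac_eq; apply/eqP.
  apply: (etrans (mE f g')); apply: etrans (esym (mE f' g)).
  by apply/eqP; rewrite -e3 -e1 -e2 e.
apply: val_inj; apply: (etrans e1); apply: etrans (esym e2).
apply/eqP; rewrite e3; apply/eqP.
by apply: (etrans (esym (mE f g'))); rewrite e; apply: mE.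
Qed.

Lemma frac_mul f g f' g' : const_coef g != 0 -> const_coef g' != 0 ->
  Bfrac f g * Bfrac f' g' = Bfrac (f * f') (g * g').
Proof.
move=> g0 g0'; apply: val_inj; rewrite /= !fracE ?const_coefM ?mulf_neq0 //=.
by rewrite !tofracM mulf_div.
Qed.

Lemma frac_add f g f' g' : const_coef g != 0 -> const_coef g' != 0 ->
  Bfrac f g + Bfrac f' g' = Bfrac (f * g' + f' * g) (g * g').
Proof.
move=> g0 g0'; apply: val_inj; rewrite /= !fracE ?const_coefM ?mulf_neq0 //=.
by rewrite !tofracM tofracD !tofracM addf_div // ?tofrac_neq0.
Qed.

Lemma frac_self g : const_coef g != 0 -> Bfrac g g = 1.
Proof. by move=> g0; apply: val_inj; rewrite /= fracE // divff // tofrac_neq0. Qed.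

Lemma frac_exp f g n : const_coef g != 0 -> Bfrac f g ^+ n = Bfrac (f ^+ n) (g ^+ n).
Proof.
move=> g0; elim: n => [|n IH]; first by rewrite !expr0 frac_self // const_coef1 oner_neq0.
by rewrite !exprS IH frac_mul // const_coefX expf_neq0.
Qed.

Lemma residue_morphism : exists rho : {rmorphism A -> k},
  forall f g, const_coef g != 0 -> rho (Bfrac f g) = const_coef f / const_coef g.
Proof.
have resE z : exists c, forall f g, const_coef g != 0 -> z = Bfrac f g ->
    c = const_coef f / const_coef g.
  have [f [g [g0 ->]]] := BlocE z; exists (const_coef f / const_coef g).
  move=> f' g' g0' /(eq_frac _ _ g0 g0')/(congr1 const_coef).
  by rewrite !const_coefM => e; apply/eqP; rewrite eqr_div // e.
have [rho rhoP] := choice resE.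
have rhoE f g : const_coef g != 0 -> rho (Bfrac f g) = const_coef f / const_coef g.
  by move=> g0; apply: rhoP.
have rho1 : rho 1 = 1.
  by rewrite -(@frac_self 1) ?rhoE ?const_coef1 ?oner_neq0 ?divr1.
have rhoM x y : rho (x * y) = rho x * rho y.
  have [f [g [g0 ->]]] := BlocE x; have [f' [g' [g0' ->]]] := BlocE y.
  by rewrite frac_mul // !rhoE ?const_coefM ?mulf_neq0 // mulf_div.
have rhoD x y : rho (x + y) = rho x + rho y.
  have [f [g [g0 ->]]] := BlocE x; have [f' [g' [g0' ->]]] := BlocE y.
  by rewrite frac_add // !rhoE ?const_coefM ?const_coefD ?mulf_neq0 // addf_div // !const_coefM.
have rhoB : zmod_morphism rho.
  by move=> x y; apply: (@addIr _ (rho y)); rewrite -rhoD !subrK.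
pose r : {rmorphism A -> k} := HB.pack rho
  (GRing.isZmodMorphism.Build A k rho rhoB)
  (GRing.isMonoidMorphism.Build A k rho (conj rho1 rhoM)).
by exists r.
Qed.

Section Localize.
Variables (p : nat) (hp : p \in [pchar k]) (e : nat).
Local Notation q := (p ^ e)%N.
Local Notation FA := (frobenius_push (pchar_Bloc a b hp) e).

Lemma q_gt0 : (0 < q)%N.
Proof. by rewrite expn_gt0 prime_gt0 // (pcharf_prime hp). Qed.

(** Writing [f / g = f g^(q-1) / g^q] forces the value at [f / g]; that it does not
    depend on the fraction follows from the semilinearity of [psi]. *)
Lemma cartier_localize (psi : B -> B) : cartier_linear q psi ->
  exists phi : {scalar FA}, forall f g, const_coef g != 0 ->
    phi (Bfrac f g) = Bfrac (psi (f * g ^+ q.-1)) g.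
Proof.
move=> [psiD psiM].
have expq (g : B) : g ^+ q = g * g ^+ q.-1 by rewrite -exprS prednK // q_gt0.
have ex z : exists y, forall f g, const_coef g != 0 -> z = Bfrac f g ->
    y = Bfrac (psi (f * g ^+ q.-1)) g.
  have [f [g [g0 ->]]] := BlocE z; exists (Bfrac (psi (f * g ^+ q.-1)) g).
  move=> f' g' g0' /(eq_frac _ _ g0 g0') fg; apply/eq_frac => //.
  rewrite [_ * g']mulrC [_ * g]mulrC -!psiM; congr psi; rewrite !expq.
  transitivity ((f * g') * (g' ^+ q.-1 * g ^+ q.-1)); first by ring.
  by rewrite fg; ring.
have [Phi PhiP] := choice ex.
have PhiE f g : const_coef g != 0 -> Phi (Bfrac f g) = Bfrac (psi (f * g ^+ q.-1)) g.
  by move=> g0; apply: PhiP.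
have PhiD x y : Phi (x + y) = Phi x + Phi y.
  have [f [g [g0 ->]]] := BlocE x; have [f' [g' [g0' ->]]] := BlocE y.
  rewrite frac_add // !PhiE ?const_coefM ?mulf_neq0 // frac_add //.
  congr Bfrac; rewrite [X in _ = X + _]mulrC [X in _ = _ + X]mulrC -!psiM -psiD.
  by congr psi; rewrite !expq exprMn; ring.
have PhiM c x : Phi (c ^+ q * x) = c * Phi x.
  have [f [g [g0 ->]]] := BlocE x; have [f' [g' [g0' ->]]] := BlocE c.
  have gq0 : const_coef (g' ^+ q) != 0 by rewrite const_coefX expf_neq0.
  rewrite frac_exp // frac_mul // !PhiE ?const_coefM ?mulf_neq0 // frac_mul //.
  apply/eq_frac; rewrite ?const_coefM ?mulf_neq0 //.
  have -> : f' ^+ q * f * (g' ^+ q * g) ^+ q.-1 =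
      (f' * g' ^+ q.-1) ^+ q * (f * g ^+ q.-1).
    by rewrite !exprMn -!exprM [(q.-1 * q)%N]mulnC; ring.
  by rewrite psiM expq; ring.
have [|phi phiE] := @scalar_form A FA Phi.
  by move=> c x y; rewrite PhiD PhiM.
by exists phi => f g g0; rewrite phiE; exact: PhiE.
Qed.
End Localize.
End Localization.

(** * Lattice points of the slab *)

Section Slab.
Variables (a b q : nat).

Definition in_slab (r s t : nat) :=
  [&& (r < q)%N, (s < q)%N, (t < a * r + q)%N & (t < b * s + q)%N].

(** A point of the slab is recorded by [r], [s] and the height of [t] above its
    least admissible value [max (a r, b s)]; [t] itself may exceed [q]. *)
Definition slab_index := {x : 'I_q * 'I_q * 'I_q |
  (maxn (a * x.1.1) (b * x.1.2) + x.2 < minn (a * x.1.1) (b * x.1.2) + q)%N}.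
Definition slab_r (x : slab_index) : nat := (val x).1.1.
Definition slab_s (x : slab_index) : nat := (val x).1.2.
Definition slab_t (x : slab_index) : nat :=
  (maxn (a * slab_r x) (b * slab_s x) + (val x).2)%N.

Lemma slab_index_cone x : in_cone a b (slab_r x) (slab_s x) (slab_t x).
Proof. by rewrite /in_cone /slab_t; lia. Qed.

Lemma slab_index_slab x : in_slab (slab_r x) (slab_s x) (slab_t x).
Proof.
rewrite /in_slab /slab_t; case: x => -[[r s] l] /= lt.
by rewrite /slab_r /slab_s /= !ltn_ord /=; lia.
Qed.

Lemma slab_index_surj r s t : in_cone a b r s t -> in_slab r s t ->
  exists x, [/\ slab_r x = r, slab_s x = s & slab_t x = t].
Proof.
move=> /andP[h1 h2] /and4P[rq sq h3 h4].
have lq : (t - maxn (a * r) (b * s) < q)%N by lia.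
pose y := (Ordinal rq, Ordinal sq, Ordinal lq).
have yP : (maxn (a * y.1.1) (b * y.1.2) + y.2 < minn (a * y.1.1) (b * y.1.2) + q)%N.
  by rewrite /=; lia.
exists (exist _ y yP : slab_index); split=> //.
by rewrite /slab_t /slab_r /slab_s /=; lia.
Qed.

Lemma slab_index_inj x y : slab_r x = slab_r y -> slab_s x = slab_s y ->
  slab_t x = slab_t y -> x = y.
Proof.
rewrite /slab_t => er es; rewrite er es => /addnI el; apply: val_inj.
move: er es el; rewrite /slab_r /slab_s.
case: (val x) => [[r s] l]; case: (val y) => [[r' s'] l'] /=.
by move=> /val_inj -> /val_inj -> /val_inj ->.
Qed.

Lemma card_slab_index : #|{: slab_index}| = slab_count a b q.
Proof.
rewrite card_sig -sum1_card -(pair_big_dep xpredT (fun (x : 'I_q * 'I_q) (l : 'I_q) =>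
  (maxn (a * x.1) (b * x.2) + l < minn (a * x.1) (b * x.2) + q)%N)
  (fun _ _ => 1%N)) /=.
rewrite -(pair_bigA _ (fun r s : 'I_q => \sum_(l < q | (maxn (a * r) (b * s) + l <
    minn (a * r) (b * s) + q)%N) 1%N)) /=.
rewrite /slab_count big_mkord; apply: eq_bigr => r _.
rewrite big_mkord; apply: eq_bigr => s _.
set M := maxn _ _; set m := minn _ _.
have -> : tent q (a * r) (b * s) = (q - (M - m))%N by rewrite /tent; lia.
have tq : (q - (M - m) <= q)%N by lia.
rewrite -[RHS]muln1 -[in RHS](subn0 (q - (M - m))%N) -sum_nat_const_nat.
rewrite big_mkord (big_ord_widen _ (fun=> 1%N) tq).
by apply: eq_bigl => l; have := ltn_ord l; lia.
Qed.
End Slab.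

(** * The dual forms *)

Section FreeRank.
Variables (k : fieldType) (p : nat) (hp : p \in [pchar k]) (e : nat).
Variables (a b : nat).
Local Notation q := (p ^ e)%N.
Local Notation T := {poly {poly {poly k}}}.
Local Notation B := (Balg k a b).
Local Notation A := (Bloc k a b).
Local Notation FA := (frobenius_push (pchar_Bloc a b hp) e).

Let q0 : (0 < q)%N := q_gt0 hp e.

Definition decimate3 (pi : k -> k) (r s t : nat) : T -> T :=
  decimate q s (decimate q r (decimate q t pi)).

Lemma coef_decimate3 pi r s t f i j l : cartier_linear q pi ->
  (decimate3 pi r s t f)`_i`_j`_l = pi f`_(q * i + s)`_(q * j + r)`_(q * l + t).
Proof.
move=> piC; have pi0 := cartier_linear0 piC.
have z1 : decimate q t pi 0 = 0.
  by apply/polyP => m; rewrite coef_decimate // !coef0.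
have z2 : decimate q r (decimate q t pi) 0 = 0.
  by apply/polyP => m; rewrite coef_decimate // !coef0.
by rewrite /decimate3 coef_decimate // coef_decimate // coef_decimate.
Qed.

Lemma decimate3_cartier pi r s t : cartier_linear q pi ->
  (r < q)%N -> (s < q)%N -> (t < q)%N -> cartier_linear q (decimate3 pi r s t).
Proof.
move=> piC rq sq tq.
have h1 : p \in [pchar {poly k}] by rewrite pchar_poly.
have h2 : p \in [pchar {poly {poly k}}] by rewrite pchar_poly.
have d1 := decimate_cartier hp (erefl q) tq piC.
have d2 := decimate_cartier h1 (erefl q) rq d1.
exact: (decimate_cartier h2 (erefl q) sq d2).
Qed.

(** When [pi] is a coordinate of [k] over [k^q], this is the form dual to the
    corresponding multiple of [u^r v^s x^t], before localization. *)
Definition slab_proj (pi : k -> k) (r s t : nat) (f : B) : B :=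
  to_Balg a b (decimate3 pi r s t (ia_val f)).

(** The exponents stay in the cone: if [q * l + t >= a * (q * i + r)] while
    [t < a * r + q], then [l + 1 > a * i]. *)
Lemma val_slab_proj pi r s t f : cartier_linear q pi -> in_slab a b q r s t ->
  ia_val (slab_proj pi r s t f) = decimate3 pi r s t (ia_val f).
Proof.
move=> piC slab; apply: to_BalgK => i j l; rewrite coef_decimate3 //.
have pi0 := cartier_linear0 piC => nz.
have : (ia_val f)`_(q * j + s)`_(q * i + r)`_(q * l + t) != 0.
  by apply: contraNneq nz => ->; rewrite pi0.
move/Balg_supported; move: slab; rewrite /in_slab /in_cone.
move=> /and4P[_ _ h1 h2] /andP[h3 h4]; apply/andP; split.
  rewrite leqNgt; apply/negP => h5.
  have : (q * l.+1 <= q * (a * i))%N by rewrite leq_pmul2l.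
  by nia.
rewrite leqNgt; apply/negP => h5.
have : (q * l.+1 <= q * (b * j))%N by rewrite leq_pmul2l.
by nia.
Qed.

(** Decimation is only linear for offsets below [q], and [t] need not be: on
    elements of the algebra the offset [t] amounts to the offset [t %% q]
    followed by a division by a power of [x], the lower coefficients being
    outside the cone. *)
Lemma slab_proj_shift pi r s t f : cartier_linear q pi ->
  in_cone a b r s t -> in_slab a b q r s t ->
  ('X^(t %/ q))%:P%:P * ia_val (slab_proj pi r s t f) =
  decimate3 pi r s (t %% q) (ia_val f).
Proof.
move=> piC cone slab; rewrite (val_slab_proj _ piC slab).
apply/polyP => i; apply/polyP => j; apply/polyP => l.
rewrite coefCM coefCM coefXnM (coef_decimate3 _ _ _ _ _ _ _ piC).
have tE := divn_eq t q; have tq := ltn_pmod t q0.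
case: ltnP => [lt|le]; last first.
  rewrite (coef_decimate3 _ _ _ _ _ _ _ piC); congr (pi _`_ _).
  by rewrite {2}tE mulnBr; nia.
apply/esym; rewrite (coef_decimate3 _ _ _ _ _ _ _ piC).
suff -> : (ia_val f)`_(q * i + s)`_(q * j + r)`_(q * l + t %% q) = 0.
  exact: cartier_linear0 piC.
apply/eqP; apply: contraT => /Balg_supported; move: slab cone; rewrite /in_slab /in_cone.
move=> /and4P[_ _ h1 h2] /andP[h3 h4] /andP[h5 h6].
have : (q * l.+1 <= q * (t %/ q))%N by rewrite leq_pmul2l.
by move: tE tq h5; move: (t %/ q)%N (t %% q)%N => u v; nia.
Qed.

Lemma slab_proj_cartier pi r s t : cartier_linear q pi ->
  in_cone a b r s t -> in_slab a b q r s t -> cartier_linear q (slab_proj pi r s t).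
Proof.
move=> piC cone slab; have /and4P[rq sq _ _] := slab.
have [dD dM] := decimate3_cartier piC rq sq (ltn_pmod t q0).
have Xn0 : ('X^(t %/ q))%:P%:P != 0 :> T by rewrite !polyC_eq0 -size_poly_eq0 size_polyXn.
have sh f := slab_proj_shift f piC cone slab.
have vD (x y : B) : ia_val (x + y) = ia_val x + ia_val y by [].
have vM (x y : B) : ia_val (x * y) = ia_val x * ia_val y by [].
have vX (x : B) n : ia_val (x ^+ n) = ia_val x ^+ n by exact: (rmorphXn val).
split=> [x y|c x]; apply: val_inj; apply: (mulfI Xn0).
  by apply: (etrans (sh _)); rewrite vD dD -!sh -mulrDr.
apply: (etrans (sh _)); rewrite vM vX dM -sh mulrCA; congr (_ * _).
Qed.

End FreeRank.

(** * The maximal free rank *)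

Section MonomialProduct.
Variable k : fieldType.
Local Notation T := {poly {poly {poly k}}}.

Lemma coef_monomialM (h : T) r s t i j l :
  (monomial k r s t * h)`_(s + i)`_(r + j)`_(t + l) = h`_i`_j`_l.
Proof.
rewrite /monomial -scalerAl coefZ coefXnM ltnNge leq_addr /= addKn.
rewrite -scalerAl coefZ coefXnM ltnNge leq_addr /= addKn.
by rewrite coefXnM ltnNge leq_addr /= addKn.
Qed.

Lemma coef_monomialM0 (h : T) r s t i j l :
  [|| (i < s)%N, (j < r)%N | (l < t)%N] ->
  (monomial k r s t * h)`_i`_j`_l = 0.
Proof.
move=> H; rewrite /monomial -scalerAl coefZ coefXnM.
case: (ltnP i s) H => [_ _|_ H]; first by rewrite mulr0 !coef0.
rewrite -scalerAl coefZ coefXnM.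
case: (ltnP l t) H => [//|_]; rewrite /= orbF coefXnM => ->.
exact: coef0.
Qed.
End MonomialProduct.

Section FreeRank.
Variables (k : fieldType) (p : nat) (hp : p \in [pchar k]) (e : nat).
Variables (a b : nat).
Local Notation q := (p ^ e)%N.
Local Notation T := {poly {poly {poly k}}}.
Local Notation B := (Balg k a b).
Local Notation A := (Bloc k a b).
Local Notation FA := (frobenius_push (pchar_Bloc a b hp) e).
Local Notation idx := (slab_index a b q).

Let q0 : (0 < q)%N := q_gt0 hp e.

Definition to_Bloc (f : B) : A := Bfrac f 1.

Let c1 : const_coef (1 : B) != 0.
Proof. by rewrite const_coef1 oner_neq0. Qed.

Lemma to_BlocD f g : to_Bloc (f + g) = to_Bloc f + to_Bloc g.
Proof. by rewrite /to_Bloc frac_add // !mulr1. Qed.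

Lemma to_BlocM f g : to_Bloc (f * g) = to_Bloc f * to_Bloc g.
Proof. by rewrite /to_Bloc frac_mul // mulr1. Qed.

Lemma to_BlocX f n : to_Bloc (f ^+ n) = to_Bloc f ^+ n.
Proof. by rewrite /to_Bloc frac_exp // expr1n. Qed.

Lemma to_Bloc1 : to_Bloc 1 = 1.
Proof. exact: frac_self. Qed.

Lemma to_Bloc0 : to_Bloc 0 = 0.
Proof. by apply: (addrI (to_Bloc 0)); rewrite -to_BlocD !addr0. Qed.

Lemma to_Bloc_sum (I : finType) (F : I -> B) :
  to_Bloc (\sum_i F i) = \sum_i to_Bloc (F i).
Proof. exact: (big_morph to_Bloc to_BlocD to_Bloc0). Qed.

Lemma to_BlocN f : to_Bloc (- f) = - to_Bloc f.
Proof. by apply: (addrI (to_Bloc f)); rewrite -to_BlocD !subrr to_Bloc0. Qed.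

Lemma frob_scaleE (c : A) (x : FA) : c *: x = c ^+ q * (x : A) :> A.
Proof. by []. Qed.

(** Two points of the slab congruent modulo [q] coincide, so the projections are
    dual to the monomials of the slab. *)
Lemma slab_proj_term (pi : k -> k) c (x y : idx) : cartier_linear q pi ->
  slab_proj p e pi (slab_r x) (slab_s x) (slab_t x)
    (term a b c (slab_r y) (slab_s y) (slab_t y)) =
  if x == y then scalar_elt a b (pi c) else 0.
Proof.
move=> piC; apply: val_inj.
have slabx := slab_index_slab x; have slaby := slab_index_slab y.
have conex := slab_index_cone x; have coney := slab_index_cone y.
apply: (etrans (val_slab_proj hp _ piC slabx)).
apply/polyP => i; apply/polyP => j; apply/polyP => l.
rewrite (coef_decimate3 hp _ _ _ _ _ _ _ piC) (val_term _ coney) coef_term.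
have -> : (q * l + slab_t x == slab_t y)%N && (q * j + slab_r x == slab_r y)%N
    && (q * i + slab_s x == slab_s y)%N = [&& x == y, i == 0, j == 0 & l == 0]%N.
  apply/idP/idP; last first.
    by move=> /and4P[/eqP-> /eqP-> /eqP-> /eqP->]; rewrite !muln0 !eqxx.
  move=> /andP[/andP[/eqP lt /eqP jr] /eqP is_].
  move: slabx slaby conex coney; rewrite /in_slab /in_cone.
  move=> /and4P[h1 h2 h3 h4] /and4P[h5 h6 h7 h8] /andP[h9 h10] /andP[h11 h12].
  have i0 : i = 0%N by nia.
  have j0 : j = 0%N by nia.
  have er : slab_r x = slab_r y by nia.
  have es : slab_s x = slab_s y by nia.
  have l0 : l = 0%N by rewrite er in h9; nia.
  have et : slab_t x = slab_t y by rewrite -lt l0 muln0.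
  by rewrite i0 j0 l0 (slab_index_inj er es et) !eqxx.
case: eqP => _ /=; last by rewrite (cartier_linear0 piC) !coef0.
rewrite (val_scalar_elt a b (pi c)) coefC; case: i => [|i] /=.
  rewrite coefC; case: j => [|j] /=; last by rewrite (cartier_linear0 piC) coef0.
  by rewrite coefC; case: l => [|l] //=; rewrite (cartier_linear0 piC).
by rewrite (cartier_linear0 piC) !coef0.
Qed.

Section Basis.
Variables (J : finType) (w : J -> k) (pi : J -> k -> k).
Hypotheses (piC : forall j, cartier_linear q (pi j))
  (piw : forall i j, pi i (w j) = (i == j)%:R).

Definition basis_elt (ij : idx * J) : FA :=
  to_Bloc (term a b (w ij.2) (slab_r ij.1) (slab_s ij.1) (slab_t ij.1)).

Lemma free_summand_ge : has_free_summand FA #|{: idx * J}|.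
Proof.
have ex (ij : idx * J) : exists phi : {scalar FA}, forall f,
    phi (to_Bloc f) = to_Bloc (slab_proj p e (pi ij.2) (slab_r ij.1) (slab_s ij.1)
       (slab_t ij.1) f).
  have [phi phiE] := cartier_localize hp (slab_proj_cartier hp (piC ij.2)
    (slab_index_cone ij.1) (slab_index_slab ij.1)).
  by exists phi => f; rewrite [LHS]phiE // expr1n mulr1.
have [phi phiE] := choice ex.
apply: (@free_summand_card A FA (idx * J)%type basis_elt phi) => ij ij'.
rewrite [LHS]phiE (slab_proj_term _ _ _ (piC _)) piw.
have [ii|ii] := eqVneq ij.1 ij'.1; last first.
  by rewrite to_Bloc0 (_ : ij == ij' = false) //; apply: contraNF ii => /eqP->.
have -> : (ij == ij') = (ij.2 == ij'.2).
  by rewrite -pair_eqE /pair_eq /= ii eqxx.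
case: eqP => _ /=; last by rewrite rmorph0 to_Bloc0.
by rewrite rmorph1 to_Bloc1.
Qed.

End Basis.

Section Vanishing.
Variable rho : {rmorphism A -> k}.
Hypothesis rhoE : forall f g, const_coef g != 0 ->
  rho (Bfrac f g) = const_coef f / const_coef g.
Variable phi : {scalar FA}.

(** Multiplying by the [q]-th powers of the monomials [y1] and [y2] turns the
    equality [y1^q w = y2^q w'] into [y1 phi(w) = y2 phi(w')]; were [phi(w)] a
    unit, [y1 / y2] would belong to the semigroup. *)
Lemma form_vanish_shift c r s t r' s' t' r1 s1 t1 r2 s2 t2 :
  in_cone a b r s t -> in_cone a b r' s' t' ->
  in_cone a b r1 s1 t1 -> in_cone a b r2 s2 t2 ->
  (q * r1 + r = q * r2 + r')%N -> (q * s1 + s = q * s2 + s')%N ->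
  (q * t1 + t = q * t2 + t')%N ->
  (forall i j l, (r1 = r2 + i)%N -> (s1 = s2 + j)%N -> (t1 = t2 + l)%N ->
     ~~ in_cone a b i j l) ->
  rho (phi (to_Bloc (term a b c r s t))) = 0.
Proof.
move=> z z' z1 z2 er es et noz.
have eqW : to_Bloc (term a b 1 r1 s1 t1) *: (to_Bloc (term a b c r s t) : FA) =
    to_Bloc (term a b 1 r2 s2 t2) *: (to_Bloc (term a b c r' s' t') : FA).
  have eqB : term a b 1 r1 s1 t1 ^+ q * term a b c r s t =
      term a b 1 r2 s2 t2 ^+ q * term a b c r' s' t'.
    by rewrite !termX // !expr1n termM ?in_coneM // termM ?in_coneM // er es et.
  have scE u v : to_Bloc u *: (to_Bloc v : FA) = to_Bloc (u ^+ q * v).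
    by rewrite (to_BlocM (u ^+ q) v) (to_BlocX u q).
  by apply: (etrans (scE _ _)); apply: (etrans _ (esym (scE _ _))); rewrite eqB.
have := congr1 phi eqW; rewrite !linearZ /=.
have [f [g [g0 ->]]] := BlocE (phi (to_Bloc (term a b c r s t))).
have [f' [g' [g0' ->]]] := BlocE (phi (to_Bloc (term a b c r' s' t'))).
rewrite rhoE // /to_Bloc !frac_mul // !mul1r => /(eq_frac _ _ g0 g0') key.
suff -> : const_coef f = 0 by rewrite mul0r.
have vM (x y : B) : ia_val (x * y) = ia_val x * ia_val y by [].
have : ia_val (term a b 1 r1 s1 t1 * (f * g')) =
       ia_val (term a b 1 r2 s2 t2 * (f' * g)) by rewrite mulrA key -mulrA.
rewrite (vM _ (f * g')) (vM _ (f' * g)) (val_term1 k z1) (val_term1 k z2).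
move=> /(congr1 (fun h : T => h`_(s1 + 0)`_(r1 + 0)`_(t1 + 0))).
rewrite coef_monomialM.
have -> : (monomial k r2 s2 t2 * ia_val (f' * g))`_(s1 + 0)`_(r1 + 0)`_(t1 + 0) = 0.
  rewrite !addn0.
  have [|/norP[h1 /norP[h2 h3]]] := boolP [|| (s1 < s2)%N, (r1 < r2)%N | (t1 < t2)%N].
    exact: coef_monomialM0.
  rewrite -!leqNgt in h1 h2 h3.
  rewrite -(subnKC h1) -(subnKC h2) -(subnKC h3) coef_monomialM.
  apply/eqP; apply: contraT => /Balg_supported; apply: contraLR => _.
  by apply: noz; rewrite subnKC.
change (const_coef (f * g') = 0 -> const_coef f = 0).
by rewrite const_coefM => /eqP; rewrite mulf_eq0 (negPf g0') orbF => /eqP.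
Qed.

Hypotheses (a0 : (0 < a)%N) (b0 : (0 < b)%N).

(** For each of the four facets, [y1 - y2] is a lattice vector on which this
    facet form is [-1] and the other three are nonnegative. *)
Lemma form_vanish_term c r s t : in_cone a b r s t -> ~~ in_slab a b q r s t ->
  rho (phi (to_Bloc (term a b c r s t))) = 0.
Proof.
move=> z; have := z; move=> /andP[ar bs].
have cone1 : in_cone a b 0 0 1 by rewrite /in_cone !muln0.
have coner : in_cone a b 1 0 a by rewrite /in_cone; lia.
have cones : in_cone a b 0 1 b by rewrite /in_cone; lia.
have cone0 t' : in_cone a b 0 0 t' by rewrite /in_cone; lia.
have qM m : (0 < m)%N -> (q * m = q + q * (m - 1))%N.
  by move=> m0; rewrite mulnBr muln1 subnKC // leq_pmulr.
rewrite /in_slab !negb_and -!leqNgt => /or4P[qr|qs|qt|qt].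
- apply: (@form_vanish_shift c r s t (r - q) s t 0 0 a 1 0 a) => //.
  + by rewrite /in_cone; nia.
  + by lia.
- apply: (@form_vanish_shift c r s t r (s - q) t 0 0 b 0 1 b) => //.
  + by rewrite /in_cone; nia.
  + by lia.
- apply: (@form_vanish_shift c r s t (r + q) s (t + q * (a - 1)) 1 0 a 0 0 1) => //.
  + by rewrite /in_cone; nia.
  + by lia.
  + by rewrite (qM _ a0); lia.
  + by move=> i j l; rewrite /in_cone; lia.
- apply: (@form_vanish_shift c r s t r (s + q) (t + q * (b - 1)) 0 1 b 0 0 1) => //.
  + by rewrite /in_cone; nia.
  + by lia.
  + by rewrite (qM _ b0); lia.
  + by move=> i j l; rewrite /in_cone; lia.
Qed.

Lemma form_vanish (f : B) :
  (forall r s t, in_slab a b q r s t -> (ia_val f)`_s`_r`_t = 0) ->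
  rho (phi (to_Bloc f)) = 0.
Proof.
move=> f0; apply: (@Balg_ind k a b (fun f => rho (phi (to_Bloc f)) = 0)).
- by rewrite to_Bloc0 raddf0 rmorph0.
- by move=> g h g0 h0; rewrite to_BlocD raddfD rmorphD /= g0 h0 addr0.
- move=> r s t nz; apply: form_vanish_term; first exact: Balg_supported nz.
  by apply: contra_neqN nz => /f0.
Qed.
End Vanishing.

Section Span.
Variables (J : finType) (w : J -> k) (pi : J -> k -> k).
Hypotheses (wE : forall x, x = \sum_j pi j x ^+ q * w j).
Variable rho : {rmorphism A -> k}.
Hypothesis rhoE : forall f g, const_coef g != 0 ->
  rho (Bfrac f g) = const_coef f / const_coef g.

(** As a scalar, [1 / g] acts through [1 / g ^ q], so [f / g] is a multiple of the
    polynomial [f g^(q-1)]; the part of the latter supported on the slab is a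
    combination of the basis elements and the rest is invisible to linear
    forms. *)
Lemma basis_elt_span (a0 : (0 < a)%N) (b0 : (0 < b)%N) (x : FA) : exists c : idx * J -> A,
  forall phi : {scalar FA}, rho (phi (x - \sum_i c i *: basis_elt w i)) = 0.
Proof.
have [f [g [g0 ->]]] := BlocE x.
pose h := f * g ^+ q.-1.
have xE : Bfrac f g = Bfrac 1 g *: (to_Bloc h : FA).
  rewrite [RHS]frob_scaleE frac_exp // expr1n frac_mul ?const_coefX ?expf_neq0 //.
  apply/eq_frac => //; first by rewrite mulr1 const_coefX expf_neq0.
  by rewrite mul1r mulr1 /h -mulrA -exprSr prednK.
pose d (i : idx * J) := pi i.2 (ia_val h)`_(slab_s i.1)`_(slab_r i.1)`_(slab_t i.1).
exists (fun i => Bfrac 1 g * to_Bloc (scalar_elt a b (d i))) => phi.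
pose W := \sum_(i : idx * J) term a b (d i ^+ q * w i.2)
   (slab_r i.1) (slab_s i.1) (slab_t i.1).
have -> : (Bfrac f g : FA) - \sum_i (Bfrac 1 g * to_Bloc (scalar_elt a b (d i))) *: basis_elt w i
    = Bfrac 1 g *: (to_Bloc (h - W) : FA).
  rewrite to_BlocD to_BlocN [RHS]scalerBr -xE; congr (_ - _).
  rewrite /W to_Bloc_sum scaler_sumr; apply: eq_bigr => i _.
  rewrite -scalerA; congr (_ *: _); rewrite [LHS]frob_scaleE /basis_elt.
  rewrite -to_BlocX -to_BlocM /scalar_elt termX ?in_cone0 //.
  by rewrite termM ?in_coneM ?in_cone0 ?slab_index_cone // !muln0.
rewrite linearZ rmorphM /= form_vanish ?mulr0 // => r s t slab.
have [z|z] := boolP (in_cone a b r s t); last first.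
  by apply/eqP; apply: contraT => /Balg_supported; rewrite (negPf z).
have [i0 [<- <- <-]] := slab_index_surj z slab.
have -> : ia_val (h - W) = ia_val h - ia_val W by [].
have -> : ia_val W = \sum_(i : idx * J) ia_val (term a b (d i ^+ q * w i.2)
   (slab_r i.1) (slab_s i.1) (slab_t i.1)).
  exact: (big_morph (@ia_val _ _ _) (id1 := 0) (op1 := +%R)).
rewrite !coefB !coef_sum; apply/eqP; rewrite subr_eq0; apply/eqP.
rewrite [LHS]wE.
transitivity (\sum_(i : idx) \sum_(j : J) if i == i0 then d (i, j) ^+ q * w j else 0).
  rewrite (bigD1 i0) //= [X in _ + X]big1 ?addr0.
    by apply: eq_bigr => j _; rewrite eqxx.
  by move=> i /negPf ->; rewrite big1.
rewrite pair_bigA; apply: eq_bigr => -[i j] _ /=.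
rewrite (val_term _ (slab_index_cone i)) coef_term.
case: eqP => [->|ne]; first by rewrite !eqxx.
case: ifP => // /andP[/andP[/eqP et /eqP er] /eqP es].
by case: ne; apply: slab_index_inj.
Qed.
End Span.

Theorem frobenius_push_free_rank n : (0 < a)%N -> (0 < b)%N ->
  frobenius_degree k p n ->
  max_free_rank FA (n ^ e * slab_count a b q).
Proof.
move=> a0 b0 /(frobenius_dual_basis hp e)[J [w [pi [cardJ piC piw wE]]]].
have card : #|{: idx * J}| = (n ^ e * slab_count a b q)%N.
  by rewrite card_prod card_slab_index cardJ mulnC.
split; first by rewrite -card; apply: (free_summand_ge piC piw).
move=> m; rewrite -card; have [rho rhoE] := residue_morphism k a b.
exact: (free_summand_le (basis_elt_span wE rhoE a0 b0)).
Qed.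
End FreeRank.

(** * The F-signature *)

Section Signature.
Variables (R : realType) (k : fieldType) (p : nat) (hp : p \in [pchar k]).

Lemma frobenius_degree_gt0 n : frobenius_degree k p n -> (0 < n)%N.
Proof.
move=> [w [span _]]; have [c] := span 1.
by case: n w span c => // w _ c /eqP; rewrite big_ord0 oner_eq0.
Qed.

Lemma powR_surj n : (0 < n)%N -> exists alpha : R, p%:R `^ alpha = n%:R.
Proof.
move=> n0; have p1 : (1 < p)%N by rewrite prime_gt1 // (pcharf_prime hp).
have lnp : ln (p%:R : R) != 0 by rewrite gt_eqF // ln_gt0 // ltr1n.
exists (ln n%:R / ln p%:R); rewrite /powR ifF; last first.
  by rewrite pnatr_eq0 gtn_eqF // ltnW.
by rewrite divfK // lnK // posrE ltr0n.
Qed.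

Lemma F_signature_of_tent_sum (a b : nat) (L : R) :
  F_finite k p -> (0 < a)%N -> (0 < b)%N ->
  (forall q, `|(tent_sum q (a * q) (b * q))%:R - a%:R * b%:R * L * q%:R ^+ 3|
     <= q%:R) ->
  is_F_signature hp a b L.
Proof.
move=> [n ndeg] a0 b0 bound; have n0 := frobenius_degree_gt0 ndeg.
have p1 : (1 < p)%N by rewrite prime_gt1 // (pcharf_prime hp).
have [alpha pn] := powR_surj n0.
exists 3%N, n, alpha, (fun e => n ^ e * slab_count a b (p ^ e))%N; split=> //.
- exact: Balg_krull_dim.
- by move=> e; apply: frobenius_push_free_rank.
rewrite (_ : (fun _ => _) =
    (fun e => (slab_count a b (p ^ e))%:R / (p ^ e)%:R ^+ 3)).
  exact: slab_count_cvg.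
apply/funext => e; rewrite (powR_frobenius e (ltnW p1) pn) natrM.
have ne : ((n ^ e)%:R : R) != 0 by rewrite pnatr_eq0 -lt0n expn_gt0 n0.
by rewrite [X in X / _]mulrC -mulf_div divff // mulr1.
Qed.
End Signature.

Theorem proposition3p2 (R : realType) (k : fieldType) (p : nat)
    (hp : p \in [pchar k]) (hF : F_finite k p)
    (a b : nat) (ha : (0 < a)%N) (hb : (0 < b)%N) :
  ((b < a)%N ->
     is_F_signature hp a b
       ((3 * b%:R - 1) / (6 * a%:R * b%:R) + 1 / (2 * a%:R) : R) /\
     (3 * b%:R - 1) / (6 * a%:R * b%:R) + 1 / (2 * a%:R)
       = (6 * b%:R - 1) / (6 * a%:R * b%:R) :> R) /\
  (a = b ->
     is_F_signature hp a b (2 * ((3 * a%:R - 1) / (6 * a%:R ^+ 2)) : R) /\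
     2 * ((3 * a%:R - 1) / (6 * a%:R ^+ 2))
       = (3 * a%:R - 1) / (3 * a%:R ^+ 2) :> R).
Proof.
have a0 : (a%:R : R) != 0 by rewrite pnatr_eq0 -lt0n.
have b0 : (b%:R : R) != 0 by rewrite pnatr_eq0 -lt0n.
split=> [ba|ab].
  have sE : (3 * b%:R - 1) / (6 * a%:R * b%:R) + 1 / (2 * a%:R)
       = (6 * b%:R - 1) / (6 * a%:R * b%:R) :> R by field; rewrite a0 b0.
  split=> //; rewrite sE; apply: F_signature_of_tent_sum => // q.
  exact: tent_sum_gt_bound.
have sE : 2 * ((3 * a%:R - 1) / (6 * a%:R ^+ 2))
       = (3 * a%:R - 1) / (3 * a%:R ^+ 2) :> R by field.
subst b; split=> //; rewrite sE; apply: F_signature_of_tent_sum => // q.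
exact: tent_sum_eq_bound.
Qed.
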